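(* There is an absolute constant $c>0$ (not depending on the Hilbert space, on $n$, on $\lambda$, or on the distribution of the data) such that, for the functions $R$ and $\hat R$ associated with regularized least squares with parameter $\lambda\in(0,1)$ and an i.i.d. sample $\mathbf{Z}=(Z_1,\dots,Z_n)$ with values in $\mathcal{Z}=\mathbb{B}\times[-1,1]$, for every $t>0$, $$\Pr\left\{(R-\hat R)(\mathbf{Z})-E\left[(R-\hat R)(\mathbf{Z})\right]>t\right\}\le\exp\left(\frac{-nt^2}{2nE\left[\Sigma^2(R-\hat R)(\mathbf{Z})\right]+c\lambda^{-3}t}\right).$$
   Context: $H$ is a separable real Hilbert space, $\mathbb{B}$ its unit ball, $\mathcal{Z}=\mathbb{B}\times[-1,1]$. Fix $\lambda\in(0,1)$. For $\mathbf{z}=((x_1,y_1),\dots,(x_n,y_n))\in\mathcal{Z}^n$, regularized least squares returns $$w_{\mathbf{z}}=\arg\min_{w\in H}\frac1n\sum_{i=1}^n\left(\langle w,x_i\rangle-y_i\right)^2+\lambda\|w\|^2 .$$ $\mathbf{Z}=(Z_1,\dots,Z_n)$ is a vector of independent random variables with values in $\mathcal{Z}$, each $Z_i$ identically distributed to $Z=(X,Y)$. The true and empirical errors are the functions on $\mathcal{Z}^n$ $$R(\mathbf{z})=E_{Z}\left(\langle w_{\mathbf{z}},X\rangle-Y\right)^2,\qquad\hat R(\mathbf{z})=\frac1n\sum_{i=1}^n\left(\langle w_{\mathbf{z}},x_i\rangle-y_i\right)^2 .$$ Sum of conditional variances: let $\mu_0$ be the distribution of $Z$. For bounded measurable $f:\mathcal{Z}^n\to\mathbb{R}$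 and $k\in\{1,\dots,n\}$, let $(S_y^kf)(z_1,\dots,z_n)=f(z_1,\dots,z_{k-1},y,z_{k+1},\dots,z_n)$ for $y\in\mathcal{Z}$, $E_kf=\int_{\mathcal{Z}}S_y^kf\,d\mu_0(y)$, $\sigma_k^2(f)=E_k[(f-E_kf)^2]$, and $\Sigma^2(f)=\sum_{k=1}^n\sigma_k^2(f)$, a function on $\mathcal{Z}^n$. *)

(* Defs.v *)
From HB Require Import structures.
From mathcomp Require Import all_boot all_order all_algebra.
From mathcomp Require Import all_classical all_reals all_analysis.

Set Implicit Arguments.
Unset Strict Implicit.
Unset Printing Implicit Defensive.

Import Order.TTheory GRing.Theory Num.Theory.
Import numFieldNormedType.Exports.

Local Open Scope classical_set_scope.
Local Open Scope ring_scope.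

(* A real Hilbert space is rendered as a complete normed module H over R with
   a positive definite symmetric bilinear form ip : {dot H for idfun} that
   induces its norm. *)
Definition induces_norm (R : realType) (H : completeNormedModType R)
  (ip : {dot H for idfun}) : Prop :=
  forall x : H, ip x x = `|x| ^+ 2.

Definition separable_space (T : topologicalType) : Prop :=
  exists A : set T, countable A /\ dense A.

(* For separable H the product sigma-algebra of the Borel sigma-algebras of H
   and R is the Borel sigma-algebra of H * R. *)
Notation borel T := (g_sigma_algebraType (@open T)).
Notation example H R := (borel H * R)%type.

Definition mutually_independent d d' (Omega : measurableType d)
    (T : measurableType d') (R : realType) (P : probability Omega R) (n : nat)
    (Z : 'I_n -> Omega -> T) : Prop :=
  forall (J : {set 'I_n}) (A : 'I_n -> set T),
    (forall i, i \in J -> measurable (A i)) ->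
    P (\bigcap_(i in [set i | i \in J]) (Z i @^-1` A i)) =
    (\prod_(i in J) P (Z i @^-1` A i))%E.

Section conditional_variance.
Context d (T : measurableType d) (R : realType).
Variables (mu0 : probability T R) (D : set T) (n : nat).
Implicit Types (f : n.-tuple T -> R) (k : 'I_n) (z : n.-tuple T).

Definition subst_coord k (y : T) z : n.-tuple T :=
  [tuple if i == k then y else tnth z i | i < n].

(* The sample space is the subset D of T, on which mu0 is concentrated. *)
Definition cond_exp k f z : R := \int[mu0]_(y in D) f (subst_coord k y z).

Definition cond_var k f : n.-tuple T -> R :=
  cond_exp k (fun z => (f z - cond_exp k f z) ^+ 2).

Definition sum_cond_var f z : R := \sum_(k < n) cond_var k f z.

End conditional_variance.

Section regularized_least_squares.
Context (R : realType) (H : completeNormedModType R).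
Variable ip : {dot H for idfun}.

Definition sample_space : set (example H R) :=
  [set z | `|z.1 : H| <= 1 /\ -1 <= z.2 <= 1].

Definition square_loss (w : H) (z : example H R) : R := (ip w z.1 - z.2) ^+ 2.

Definition empirical_risk (n : nat) (z : n.-tuple (example H R)) (w : H) : R :=
  n%:R^-1 * \sum_(i < n) square_loss w (tnth z i).

Definition rls_objective (lam : R) (n : nat) (z : n.-tuple (example H R))
  (w : H) : R := empirical_risk z w + lam * `|w| ^+ 2.

(* The minimizer exists and is unique for 0 < lam; the default 0 is never
   used in that case. *)
Definition rls (lam : R) (n : nat) (z : n.-tuple (example H R)) : H :=
  xget 0 [set w | forall v, rls_objective lam z w <= rls_objective lam z v].

Definition true_error (mu0 : probability (example H R) R) (lam : R) (n : nat)
    (z : n.-tuple (example H R)) : R :=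
  \int[mu0]_(x in sample_space) square_loss (rls lam z) x.

Definition empirical_error (lam : R) (n : nat) (z : n.-tuple (example H R)) : R :=
  empirical_risk z (rls lam z).

End regularized_least_squares.

(* Main.v *)
Require Import Defs.
From HB Require Import structures.
From mathcomp Require Import all_boot all_order all_algebra.
From mathcomp Require Import all_classical all_reals all_analysis.
From mathcomp Require Import measurable_realfun ring lra.

Set Implicit Arguments.
Unset Strict Implicit.
Unset Printing Implicit Defensive.

Import Order.TTheory GRing.Theory Num.Theory.
Import numFieldNormedType.Exports.

Local Open Scope classical_set_scope.
Local Open Scope ring_scope.

(** The gap between true and empirical error depends on the sample in a smooth
    way: changing one example moves it by at most [K / n], and its second
    differences in two distinct examples are at most [K / n ^ 2], where [K] is a
    constant times [lam ^- 3].  The inequality holds for every bounded function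
    [f] of independent variables with these two properties, so there are two
    independent tasks.

    For the probabilistic part ([Es_expR_le], [bernstein_interaction]), the
    variables are averaged out one at a time.  At the step that averages over
    the variable [k], put [F] for the partial average of [f], and [G] for the
    partial average of the conditional variances of the variables that are
    already averaged out.  One shows by induction that averaging
    [exp (beta f)] gives at most [exp (beta F + theta G)], where [theta] is
    close to [beta ^ 2 / 2].  The next average is controlled by the variance of
    [beta F + theta G] in the variable [k].  The variance of [F] is at most the
    average of the conditional variance of [f], by Jensen's inequality, and
    becomes the new summand of [G].  The variance of [G] is harmless because [G]
    is the square of an [L2] norm of the functions [f - E_j f], each of which
    moves by at most [K / n ^ 2]; hence [G] is self-bounding
    ([tail_var_self_bounding]) and its variance is at most a multiple of
    [K ^ 2 G / n ^ 3].  Summed over the [n] steps this raises [theta] by a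
    relative amount of order [beta K / n] only.  When all variables are averaged
    out, [F] is the expectation of [f] and [G] is the expectation of the sum of
    the conditional variances, so that the logarithm of the moment generating
    function is at most [beta ^ 2 V (1 + O (beta K / n)) / 2], which is
    Bernstein's bound.

    For the analytic part, the minimizer is the solution of the normal equation
    [lam w + (1/n) sum_i (<w, x_i> - y_i) x_i = 0], whose linear part is
    bounded below by [lam] ([coercive]).  Subtracting the normal equations of
    two samples bounds the first differences of the minimizer ([rls_dist]); in
    the alternating sum of the four normal equations attached to two changed
    examples, the terms of these two examples alone are left beside the linear
    part applied to the second difference, and each of them contains a first
    difference, whence the bound on second differences
    ([rls_second_difference]).  The loss is quadratic, so the bounds pass to the
    errors ([gap_subst], [gap_interaction]).  Measurability follows from
    the Lipschitz bound and separability ([lipschitz_measurable]). *)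

(** * Expectations of bounded measurable functions *)

Definition bounded_measurable d (T : measurableType d) (R : realType)
    (g : T -> R) :=
  measurable_fun setT g /\ exists M, forall x, `|g x| <= M.

Section bounded_measurable.
Context d (T : measurableType d) (R : realType).
Implicit Types g h : T -> R.

Lemma bmf_cst (c : R) : bounded_measurable (fun _ : T => c).
Proof. by split=> //; exists `|c|. Qed.

Lemma bmfD g h : bounded_measurable g -> bounded_measurable h ->
  bounded_measurable (fun x => g x + h x).
Proof.
move=> [mg [M Mg]] [mh [N Nh]]; split; first exact: measurable_funD.
by exists (M + N) => x; rewrite (le_trans (ler_normD _ _))// lerD.
Qed.

Lemma bmfM g h : bounded_measurable g -> bounded_measurable h ->
  bounded_measurable (fun x => g x * h x).
Proof.
move=> [mg [M Mg]] [mh [N Nh]]; split; first exact: measurable_funM.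
by exists (M * N) => x; rewrite normrM ler_pM.
Qed.

Lemma bmfZ (c : R) g : bounded_measurable g ->
  bounded_measurable (fun x => c * g x).
Proof. by move=> mg; apply: bmfM => //; exact: bmf_cst. Qed.

Lemma bmfB g h : bounded_measurable g -> bounded_measurable h ->
  bounded_measurable (fun x => g x - h x).
Proof.
move=> mg [mh [N Nh]]; apply: bmfD => //; split.
  exact: measurableT_comp.
by exists N => x; rewrite normrN.
Qed.

Lemma bmf_sqr g : bounded_measurable g ->
  bounded_measurable (fun x => g x ^+ 2).
Proof. by move=> mg; under eq_fun do rewrite expr2; exact: bmfM. Qed.

Lemma bmf_norm g : bounded_measurable g ->
  bounded_measurable (fun x => `|g x|).
Proof.
move=> [mg [M Mg]]; split; first exact: measurableT_comp.
by exists M => x; rewrite normr_id.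
Qed.

Lemma bmf_exp g : bounded_measurable g ->
  bounded_measurable (fun x => expR (g x)).
Proof.
move=> [mg [M Mg]]; split; first exact: measurableT_comp.
exists (expR M) => x; rewrite ger0_norm ?expR_ge0// ler_expR.
by rewrite (le_trans (ler_norm _)).
Qed.

Lemma bmf_sum (I : Type) (s : seq I) (g : I -> T -> R) :
  (forall i, bounded_measurable (g i)) ->
  bounded_measurable (fun x => \sum_(i <- s) g i x).
Proof.
move=> mg; elim: s => [|i s IH].
  by under eq_fun do rewrite big_nil; exact: bmf_cst.
by under eq_fun do rewrite big_cons; exact: bmfD.
Qed.

End bounded_measurable.

Lemma bmf_comp d d' (T : measurableType d) (U : measurableType d')
    (R : realType) (g : U -> R) (p : T -> U) :
  bounded_measurable g -> measurable_fun setT p ->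
  bounded_measurable (fun x => g (p x)).
Proof.
move=> [mg [M Mg]] mp; split; first exact: (measurableT_comp mg mp).
by exists M.
Qed.

Section expectation_bounded.
Context d (T : measurableType d) (R : realType) (mu : probability T R).
Implicit Types g h : T -> R.

Lemma bmf_integrable g : bounded_measurable g -> mu.-integrable setT (EFin \o g).
Proof.
move=> [mg [M Mg]]; apply: measurable_bounded_integrable => //.
  exact: le_lt_trans (probability_le1 _ _) (ltry 1).
exists M; split; first exact: num_real.
by move=> x Mx y _; exact: le_trans (Mg y) (ltW Mx).
Qed.

Lemma Eb_cst (c : R) : \int[mu]_x c = c.
Proof. by rewrite Rintegral_cst//= probability_setT mulr1. Qed.

Lemma EbD g h : bounded_measurable g -> bounded_measurable h ->
  \int[mu]_x (g x + h x) = \int[mu]_x g x + \int[mu]_x h x.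
Proof. by move=> mg mh; rewrite RintegralD//; exact: bmf_integrable. Qed.

Lemma EbB g h : bounded_measurable g -> bounded_measurable h ->
  \int[mu]_x (g x - h x) = \int[mu]_x g x - \int[mu]_x h x.
Proof. by move=> mg mh; rewrite RintegralB//; exact: bmf_integrable. Qed.

Lemma EbZ (c : R) g : bounded_measurable g ->
  \int[mu]_x (c * g x) = c * \int[mu]_x g x.
Proof. by move=> mg; rewrite RintegralZl//; exact: bmf_integrable. Qed.

Lemma Eb_le g h : bounded_measurable g -> bounded_measurable h ->
  (forall x, g x <= h x) -> \int[mu]_x g x <= \int[mu]_x h x.
Proof. by move=> mg mh gh; apply: le_Rintegral => //; exact: bmf_integrable. Qed.

Lemma Eb_le_cst g (c : R) : bounded_measurable g -> (forall x, g x <= c) ->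
  \int[mu]_x g x <= c.
Proof.
by move=> mg gc; rewrite -[leRHS]Eb_cst; apply: Eb_le => //; exact: bmf_cst.
Qed.

Lemma Eb_norm_le g (c : R) : bounded_measurable g -> (forall x, `|g x| <= c) ->
  `|\int[mu]_x g x| <= c.
Proof.
move=> mg gc; apply: (le_trans (le_normr_Rintegral measurableT (bmf_integrable mg))).
by apply: Eb_le_cst => //; exact: bmf_norm.
Qed.

Lemma Eb_sum (I : Type) (s : seq I) (g : I -> T -> R) :
  (forall i, bounded_measurable (g i)) ->
  \int[mu]_x (\sum_(i <- s) g i x) = \sum_(i <- s) \int[mu]_x g i x.
Proof.
move=> mg; elim: s => [|i s IH].
  by under eq_Rintegral do rewrite big_nil; rewrite Eb_cst big_nil.
under eq_Rintegral do rewrite big_cons.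
by rewrite EbD//; [rewrite big_cons IH|exact: bmf_sum].
Qed.

Lemma Eb_sqr_dist g (c : R) : bounded_measurable g ->
  \int[mu]_x (g x - c) ^+ 2 =
  \int[mu]_x g x ^+ 2 - 2 * c * \int[mu]_x g x + c ^+ 2.
Proof.
move=> mg.
transitivity (\int[mu]_x ((g x ^+ 2 - (2 * c) * g x) + c ^+ 2)).
  by apply: eq_Rintegral => x _; ring.
rewrite EbD ?EbB ?Eb_cst ?EbZ//.
- exact: bmf_sqr.
- exact: bmfZ.
- by apply: bmfB; [exact: bmf_sqr|exact: bmfZ].
- exact: bmf_cst.
Qed.

(** The variance is nonnegative. *)
Lemma Eb_jensen_sqr g : bounded_measurable g ->
  (\int[mu]_x g x) ^+ 2 <= \int[mu]_x g x ^+ 2.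
Proof.
move=> mg; rewrite -subr_ge0.
have -> : \int[mu]_x g x ^+ 2 - (\int[mu]_x g x) ^+ 2 =
    \int[mu]_x (g x - \int[mu]_x g x) ^+ 2 by rewrite Eb_sqr_dist//; ring.
by apply: Rintegral_ge0 => x _; exact: sqr_ge0.
Qed.

Lemma Eb_centered g : bounded_measurable g ->
  \int[mu]_x (g x - \int[mu]_x g x) = 0.
Proof. by move=> mg; rewrite EbB ?Eb_cst ?subrr//; exact: bmf_cst. Qed.

(** Comparing [G] with an independent copy of itself turns a self-bounding
    property of its oscillations into a bound on its variance. *)
Lemma Eb_self_bounding (G : T -> R) (c : R) : bounded_measurable G ->
  (forall y y', (G y - G y') ^+ 2 <= c * (G y + G y')) ->
  \int[mu]_y (G y - \int[mu]_x G x) ^+ 2 <= 2 * c * \int[mu]_x G x.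
Proof.
move=> mG Gc; set m := \int[mu]_x G x.
have dev y : (G y - m) ^+ 2 <= c * (G y + m).
  have -> : c * (G y + m) = \int[mu]_y' (c * (G y + G y')).
    rewrite EbZ ?EbD ?Eb_cst//; first exact: bmf_cst.
    by apply: bmfD => //; exact: bmf_cst.
  have -> : G y - m = \int[mu]_y' (G y - G y').
    by rewrite EbB ?Eb_cst//; exact: bmf_cst.
  have bB : bounded_measurable (fun y' => G y - G y').
    by apply: bmfB => //; exact: bmf_cst.
  apply: le_trans (Eb_jensen_sqr bB) _.
  apply: Eb_le => //; first exact: bmf_sqr.
  by apply: bmfZ; apply: bmfD => //; exact: bmf_cst.
have -> : 2 * c * m = \int[mu]_y (c * (G y + m)).
  rewrite EbZ ?EbD ?Eb_cst -/m//; first by ring.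
    exact: bmf_cst.
  by apply: bmfD => //; exact: bmf_cst.
apply: Eb_le => //; first by apply: bmf_sqr; apply: bmfB => //; exact: bmf_cst.
by apply: bmfZ; apply: bmfD => //; exact: bmf_cst.
Qed.

End expectation_bounded.
(** The product of the right-hand side with [expR (- u)] equals 1 at 0, and its
    derivative has the sign of [u] as long as [u <= eta]. *)
Lemma expR_quadratic_ub (R : realType) (eta u : R) : 0 <= eta <= 1 -> u <= eta ->
  expR u <= 1 + u + (1 + eta) / 2 * u ^+ 2.
Proof.
move=> /andP[eta0 eta1] ueta.
pose h (x : R) := (1 + x + (1 + eta) / 2 * x ^+ 2) * expR (- x).
pose dh (x : R) := x * (eta - (1 + eta) / 2 * x) * expR (- x).
have hdh (x : R) : is_derive x 1 h (dh x).
  rewrite /h; apply: is_derive_eq.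
  rewrite /dh /GRing.scale /=; by lra.
have ch : continuous h.
  by move=> x; apply/differentiable_continuous/derivable1_diffP; case: (hdh x).
have h0 : h 0 = 1 by rewrite /h oppr0 expR0; ring.
suff : 1 <= h u by rewrite /h expRN ler_pdivlMr ?expR_gt0// mul1r.
have [u0|u0] := leP 0 u.
  have [c cu] := MVT_segment u0 (fun x _ => hdh x) (continuous_subspaceT ch).
  move: cu; rewrite in_itv /= => /andP[c0 cu] hE.
  rewrite -h0 -subr_ge0 hE subr0 mulr_ge0// /dh mulr_ge0 ?expR_ge0//.
  by rewrite mulr_ge0//; nra.
have [c cu] := MVT_segment (ltW u0) (fun x _ => hdh x) (continuous_subspaceT ch).
move: cu; rewrite in_itv /= => /andP[uc c0] hE.
rewrite -h0 -subr_le0 hE mulr_le0_ge0//; last by lra.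
rewrite /dh mulr_le0_ge0 ?expR_ge0// mulr_le0_ge0//.
nra.
Qed.

Section mgf.
Context d (T : measurableType d) (R : realType) (mu : probability T R).

(** As [eta] tends to 0 the factor tends to the optimal 1/2; this is what makes
    the leading constant of the final inequality sharp. *)
Lemma Eb_mgf_centered (X : T -> R) (eta : R) : 0 <= eta <= 1 ->
  bounded_measurable X -> (forall x, X x <= eta) -> \int[mu]_x X x = 0 ->
  \int[mu]_x expR (X x) <= expR ((1 + eta) / 2 * \int[mu]_x X x ^+ 2).
Proof.
move=> eta01 mX Xeta EX; apply: le_trans (expR_ge1Dx _).
have mX2 : bounded_measurable (fun x => (1 + eta) / 2 * X x ^+ 2).
  by apply: bmfZ; exact: bmf_sqr.
have m1X : bounded_measurable (fun x => 1 + X x).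
  by apply: bmfD => //; exact: bmf_cst.
have -> : 1 + (1 + eta) / 2 * \int[mu]_x X x ^+ 2 =
    \int[mu]_x (1 + X x + (1 + eta) / 2 * X x ^+ 2).
  rewrite EbD// EbD//; last exact: bmf_cst.
  by rewrite Eb_cst EX EbZ ?addr0//; exact: bmf_sqr.
apply: Eb_le; [exact: bmf_exp|exact: bmfD|].
by move=> x; exact: expR_quadratic_ub.
Qed.

End mgf.

Section parametric_expectation.
Context d1 d2 (T1 : measurableType d1) (T2 : measurableType d2) (R : realType).
Variables (m : probability T2 R) (g : T1 * T2 -> R).
Hypothesis mg : bounded_measurable g.

Lemma bmf_pair1 x : bounded_measurable (fun y => g (x, y)).
Proof.
exact: (bmf_comp mg
  (measurable_fun_pair (measurable_cst x) (@measurable_id _ _ setT))).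
Qed.

Lemma bmf_pair2 y : bounded_measurable (fun x => g (x, y)).
Proof.
exact: (bmf_comp mg
  (measurable_fun_pair (@measurable_id _ _ setT) (measurable_cst y))).
Qed.

Lemma bmf_Rintegral : bounded_measurable (fun x => \int[m]_y g (x, y)).
Proof.
have [mg0 [M gM]] := mg; split; last first.
  by exists M => x; apply: Eb_norm_le => //; exact: bmf_pair1.
have gM0 z : 0 <= g z + M by have := gM z; rewrite ler_norml; lra.
have gMb x : bounded_measurable (fun y => g (x, y) + M).
  by apply: bmfD; [exact: bmf_pair1|exact: bmf_cst].
rewrite (_ : (fun x => _) = (fun x => \int[m]_y (g (x, y) + M) - M)); last first.
  apply/funext => x; rewrite EbD; [|exact: bmf_pair1|exact: bmf_cst].
  by rewrite Eb_cst addrK.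
apply: measurable_funB => //; apply/measurable_EFinP.
rewrite (_ : _ \o _ = fubini_F m (fun z => (g z + M)%:E)); last first.
  apply/funext => x; rewrite /fubini_F /= /Rintegral fineK//.
  by apply: integrable_fin_num => //; exact: bmf_integrable.
apply: measurable_fun_fubini_tonelli_F => [|z]; last by rewrite lee_fin.
by apply/measurable_EFinP; exact: measurable_funD.
Qed.

End parametric_expectation.

Section fubini.
Context d1 d2 (T1 : measurableType d1) (T2 : measurableType d2) (R : realType).
Variables (m1 : probability T1 R) (m2 : probability T2 R).
Variable g : T1 * T2 -> R.
Hypothesis mg : bounded_measurable g.

Let int_g : (m1 \x m2)%E.-integrable setT (EFin \o g).
Proof.
have [mg0 [M gM]] := mg.
apply/integrable12ltyP; first exact/measurable_EFinP.
apply: (@le_lt_trans _ _ (\int[m1]_x (`|M|)%:E)%E).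
  apply: ge0_le_integral => //.
  - by move=> x _; apply: integral_ge0.
  - apply: (@measurable_fun_fubini_tonelli_F _ _ _ _ _ m2
      (fun z => `|(g z)%:E|%E)) => //.
    by apply: measurableT_comp => //; exact/measurable_EFinP.
  - move=> x _ /=.
    apply: (@le_trans _ _ (\int[m2]_y (`|M|)%:E)%E).
      apply: ge0_le_integral => //=.
      - by do 2 apply: measurableT_comp => //; case: (bmf_pair1 mg x).
      - by move=> y _; rewrite lee_fin (le_trans (gM _))// ler_norm.
    by rewrite integral_cst//= probability_setT mule1.
by rewrite integral_cst//= probability_setT mule1 ltry.
Qed.

Let fin1 x : (\int[m2]_y (g (x, y))%:E)%E = (\int[m2]_y g (x, y))%:E.
Proof.
rewrite /Rintegral fineK//; apply: integrable_fin_num => //.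
by apply: bmf_integrable; exact: bmf_pair1.
Qed.

Let fin2 y : (\int[m1]_x (g (x, y))%:E)%E = (\int[m1]_x g (x, y))%:E.
Proof.
rewrite /Rintegral fineK//; apply: integrable_fin_num => //.
by apply: bmf_integrable; exact: bmf_pair2.
Qed.

Lemma Rintegral_fubini : \int[m1]_x \int[m2]_y g (x, y) =
  \int[m2]_y \int[m1]_x g (x, y).
Proof.
rewrite {1 3}/Rintegral; congr fine.
under eq_integral do rewrite -fin1.
under [RHS]eq_integral do rewrite -fin2.
exact: (Fubini int_g).
Qed.

Lemma Rintegral_prod : fine (\int[m1 \x m2]_z (g z)%:E)%E =
  \int[m1]_x \int[m2]_y g (x, y).
Proof.
rewrite -(integral12_prod_meas1 int_g)/= [RHS]/Rintegral; congr fine.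
by apply: eq_integral => x _; rewrite /fubini_F /= fin1.
Qed.

End fubini.
(** * Averaging over coordinates *)

Section substitution.
Context d (T : measurableType d) (n : nat).
Implicit Types (k l : 'I_n) (y : T) (z : n.-tuple T).

Lemma tnth_subst k y z i :
  tnth (subst_coord k y z) i = if i == k then y else tnth z i.
Proof. by rewrite tnth_mktuple. Qed.

Lemma substK k y y' z : subst_coord k y' (subst_coord k y z) = subst_coord k y' z.
Proof. by apply: eq_from_tnth => i; rewrite !tnth_subst; case: eqP. Qed.

Lemma substC k l y y' z : k != l ->
  subst_coord l y' (subst_coord k y z) = subst_coord k y (subst_coord l y' z).
Proof.
move=> kl; apply: eq_from_tnth => i; rewrite !tnth_subst.
by case: (eqVneq i l) => [->|//]; rewrite eq_sym (negbTE kl).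
Qed.

(** Any two points are joined by successive substitutions. *)
Lemma subst_invariant_cst (S : Type) (g : n.-tuple T -> S) :
  (forall k y z, g (subst_coord k y z) = g z) -> forall z z', g z = g z'.
Proof.
move=> gS z z'.
pose mix (s : seq 'I_n) := foldr (fun k => subst_coord k (tnth z' k)) z s.
have gmix s : g (mix s) = g z by elim: s => //= k s IH; rewrite gS.
rewrite -(gmix (enum 'I_n)); congr g; apply: eq_from_tnth => i.
suff -> s : tnth (mix s) i = if i \in s then tnth z' i else tnth z i.
  by rewrite mem_enum.
elim: s => [//|k s IH] /=; rewrite tnth_subst in_cons.
by case: eqP => [->|_].
Qed.

End substitution.

Section averaging.
Context d (T : measurableType d) (R : realType) (mu : probability T R) (n : nat).
Implicit Types (k l : 'I_n) (z : n.-tuple T) (g h : n.-tuple T -> R).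

Lemma measurable_subst k :
  measurable_fun setT (fun p : n.-tuple T * T => subst_coord k p.2 p.1).
Proof.
apply/measurable_fun_tnthP => i /=.
rewrite (_ : _ \o _ = if i == k then snd else (fun p => tnth p.1 i)); last first.
  by apply/funext => p /=; rewrite tnth_subst; case: eqP.
case: eqP => // _; apply: (measurableT_comp (measurable_tnth i)) => //.
Qed.

Lemma measurable_subst_fst k y :
  measurable_fun setT (fun z : n.-tuple T => subst_coord k y z).
Proof. exact: (measurable_fun_pair1 y (measurable_subst k)). Qed.

Lemma measurable_subst_snd k z :
  measurable_fun setT (fun y : T => subst_coord k y z).
Proof. exact: (measurable_fun_pair2 z (measurable_subst k)). Qed.

Local Notation Ek := (@cond_exp _ _ _ mu setT n).

Lemma bmf_subst k y g : bounded_measurable g ->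
  bounded_measurable (fun z => g (subst_coord k y z)).
Proof. by move=> mg; exact: bmf_comp (measurable_subst_fst k y). Qed.

Lemma bmf_fiber k z g : bounded_measurable g ->
  bounded_measurable (fun y => g (subst_coord k y z)).
Proof. by move=> mg; exact: bmf_comp (measurable_subst_snd k z). Qed.

Lemma bmf_Ek k g : bounded_measurable g -> bounded_measurable (Ek k g).
Proof.
move=> mg.
exact: (bmf_Rintegral (g := fun p : n.-tuple T * T => g (subst_coord k p.2 p.1))
  mu (bmf_comp mg (measurable_subst k))).
Qed.

Lemma Ek_subst k g y z : Ek k g (subst_coord k y z) = Ek k g z.
Proof. by rewrite /cond_exp; under eq_Rintegral do rewrite substK. Qed.

Lemma Ek_subst_neq k l g y z : l != k ->
  Ek k g (subst_coord l y z) = Ek k (fun z => g (subst_coord l y z)) z.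
Proof. by move=> lk; apply: eq_Rintegral => y' _; rewrite substC. Qed.

Lemma EkC k l g z : bounded_measurable g -> Ek k (Ek l g) z = Ek l (Ek k g) z.
Proof.
move=> mg; have [->//|kl] := eqVneq k l.
rewrite /cond_exp.
rewrite (Rintegral_fubini mu mu
  (g := fun p => g (subst_coord l p.2 (subst_coord k p.1 z)))).
  by apply: eq_Rintegral => y _; apply: eq_Rintegral => y' _ /=; rewrite substC.
apply: (bmf_comp mg).
have mk : measurable_fun setT (fun p : T * T => subst_coord k p.1 z).
  exact: (measurableT_comp (measurable_subst_snd k z) measurable_fst).
exact: (measurableT_comp (measurable_subst l)
  (measurable_fun_pair mk measurable_snd)).
Qed.

(** Iterated averages stand for conditional expectations: [Es s g] is [g]
    conditioned on the coordinates that are not listed in [s]. *)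
Definition Es (s : seq 'I_n) g : n.-tuple T -> R := foldr Ek g s.

Lemma bmf_Es s g : bounded_measurable g -> bounded_measurable (Es s g).
Proof. by move=> mg; elim: s => //= k s IH; exact: bmf_Ek. Qed.

Lemma EsD s g h : bounded_measurable g -> bounded_measurable h ->
  Es s (fun z => g z + h z) = (fun z => Es s g z + Es s h z).
Proof.
move=> mg mh; elim: s => //= k s ->; apply/funext => z.
by rewrite /cond_exp EbD//; apply: bmf_fiber; exact: bmf_Es.
Qed.

Lemma EsB s g h : bounded_measurable g -> bounded_measurable h ->
  Es s (fun z => g z - h z) = (fun z => Es s g z - Es s h z).
Proof.
move=> mg mh; elim: s => //= k s ->; apply/funext => z.
by rewrite /cond_exp EbB//; apply: bmf_fiber; exact: bmf_Es.
Qed.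

Lemma EsZ s c g : bounded_measurable g ->
  Es s (fun z => c * g z) = (fun z => c * Es s g z).
Proof.
move=> mg; elim: s => //= k s ->; apply/funext => z.
by rewrite /cond_exp EbZ//; apply: bmf_fiber; exact: bmf_Es.
Qed.

Lemma Es_cst s (c : R) z : Es s (fun=> c) z = c.
Proof.
elim: s z => //= k s IH z; rewrite /cond_exp.
by under eq_Rintegral do rewrite IH; rewrite Eb_cst.
Qed.

Lemma Es_le s g h z : bounded_measurable g -> bounded_measurable h ->
  (forall z, g z <= h z) -> Es s g z <= Es s h z.
Proof.
move=> mg mh gh; elim: s z => //= k s IH z.
by apply: Eb_le => //; apply: bmf_fiber; exact: bmf_Es.
Qed.

Lemma Es_ge0 s g z : bounded_measurable g -> (forall z, 0 <= g z) -> 0 <= Es s g z.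
Proof.
by move=> mg g0; rewrite -(Es_cst s 0 z); apply: Es_le => //; exact: bmf_cst.
Qed.

Lemma Es_norm s g z : bounded_measurable g -> `|Es s g z| <= Es s (fun z => `|g z|) z.
Proof.
move=> mg; rewrite ler_norml; apply/andP; split; last first.
  by apply: Es_le => //; [exact: bmf_norm|move=> ?; exact: ler_norm].
rewrite lerNl -mulN1r; have := EsZ s (-1) mg => /(congr1 (@^~ z)) /= <-.
apply: Es_le; [exact: bmfZ|exact: bmf_norm|move=> x].
by rewrite mulN1r -normrN ler_norm.
Qed.

Lemma Es_jensen_sqr s g z : bounded_measurable g ->
  Es s g z ^+ 2 <= Es s (fun z => g z ^+ 2) z.
Proof.
move=> mg; elim: s z => //= k s IH z.
apply: (@le_trans _ _ (Ek k (fun z => Es s g z ^+ 2) z)).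
  by apply: Eb_jensen_sqr; apply: bmf_fiber; exact: bmf_Es.
apply: Eb_le => //.
  by apply: bmf_sqr; apply: bmf_fiber; exact: bmf_Es.
by apply: bmf_fiber; apply: bmf_Es; exact: bmf_sqr.
Qed.

Lemma EkEsC k s g : bounded_measurable g -> Ek k (Es s g) = Es s (Ek k g).
Proof.
move=> mg; elim: s => //= l s <-; apply/funext => z.
by rewrite EkC//; exact: bmf_Es.
Qed.

Lemma Es_subst k s g y z : bounded_measurable g -> k \in s ->
  Es s g (subst_coord k y z) = Es s g z.
Proof.
move=> mg; elim: s z => //= l s IH z.
have [<- _|lk] := eqVneq k l; first exact: Ek_subst.
rewrite in_cons (negbTE lk) /= => ks.
by rewrite Ek_subst_neq//; apply: eq_Rintegral => y' _; rewrite IH.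
Qed.

Lemma Es_subst_notin k s g y z : k \notin s ->
  Es s g (subst_coord k y z) = Es s (fun z => g (subst_coord k y z)) z.
Proof.
elim: s z => //= l s IH z; rewrite in_cons negb_or => /andP[kl ks].
by rewrite Ek_subst_neq//; apply: eq_Rintegral => y' _; rewrite IH.
Qed.

End averaging.
(** * Exponential moments under small interactions *)

Lemma sqr_sum_le (R : realFieldType) (I : Type) (s : seq I) (a : I -> R) :
  (\sum_(i <- s) a i) ^+ 2 <= (size s)%:R * \sum_(i <- s) a i ^+ 2.
Proof.
elim: s => [|i s IH]; first by rewrite !big_nil mulr0 expr0n.
rewrite !big_cons /= -natr1.
move: IH; set S := \sum_(j <- s) a j; set Q := \sum_(j <- s) a j ^+ 2.
have Q0 : 0 <= Q by apply: sumr_ge0 => j _; exact: sqr_ge0.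
have := ler0n R (size s); set m := (size s)%:R; rewrite le_eqVlt => /predU1P[<-|m0].
  rewrite mul0r => S0; have -> : S = 0.
    by apply/eqP; rewrite -sqrf_eq0 eq_le S0 sqr_ge0.
  by rewrite addr0 add0r mul1r lerDl.
move=> SQ; rewrite -subr_ge0 -(pmulr_rge0 _ m0).
have : 0 <= (m * a i - S) ^+ 2 by exact: sqr_ge0.
nra.
Qed.

(** Keeps the constant of the first square as close to 1 as desired; the price is
    paid by the second one. *)
Lemma sqrD_weighted_le (R : realFieldType) (e a c : R) : 0 < e ->
  (a + c) ^+ 2 <= (1 + e) * a ^+ 2 + (1 + e^-1) * c ^+ 2.
Proof.
move=> e0; rewrite -subr_ge0.
have -> : (1 + e) * a ^+ 2 + (1 + e^-1) * c ^+ 2 - (a + c) ^+ 2 =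
    e^-1 * (e * a - c) ^+ 2 by field; rewrite gt_eqF.
by rewrite mulr_ge0 ?sqr_ge0// invr_ge0 ltW.
Qed.

Section interaction.
Context d (T : measurableType d) (R : realType) (mu : probability T R) (n : nat).
Variables (f : n.-tuple T -> R) (b : R).
Hypothesis b0 : 0 < b.
Hypothesis mf : bounded_measurable f.
Hypothesis f_osc : forall k y z, `|f (subst_coord k y z) - f z| <= b.
Hypothesis f_int : forall k l y y' z, k != l ->
  `|f (subst_coord l y' (subst_coord k y z)) - f (subst_coord k y z)
    - f (subst_coord l y' z) + f z| <= b / n%:R.

Local Notation Ek := (@cond_exp _ _ _ mu setT n).
Local Notation Es := (@Es _ _ _ mu n).

Definition dev k z : R := f z - Ek k f z.

Lemma bmf_dev k : bounded_measurable (dev k).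
Proof. by apply: bmfB => //; exact: bmf_Ek. Qed.
Local Hint Resolve bmf_dev : core.

Lemma dev_le k z : `|dev k z| <= b.
Proof.
have -> : dev k z = \int[mu]_y (f z - f (subst_coord k y z)).
  by rewrite /dev EbB ?Eb_cst//; [exact: bmf_cst|exact: bmf_fiber].
apply: Eb_norm_le => [|y].
  by apply: bmfB; [exact: bmf_cst|exact: bmf_fiber].
by rewrite distrC f_osc.
Qed.

(** The difference is an average over the coordinate [j] of second differences of
    [f]. *)
Lemma dev_osc k j y y' z : k != j ->
  `|dev j (subst_coord k y z) - dev j (subst_coord k y' z)| <= b / n%:R.
Proof.
move=> kj; set z1 := subst_coord k y z.
have -> : subst_coord k y' z = subst_coord k y' z1 by rewrite substK.
have mz z' : bounded_measurable (fun x => f (subst_coord j x z')).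
  exact: bmf_fiber.
have -> : dev j z1 - dev j (subst_coord k y' z1) =
    \int[mu]_x (f (subst_coord j x (subst_coord k y' z1))
      - f (subst_coord j x z1) + (f z1 - f (subst_coord k y' z1))).
  rewrite EbD; [|exact: bmfB|exact: bmf_cst].
  by rewrite EbB// Eb_cst /dev /cond_exp; lra.
apply: Eb_norm_le => [|x].
  by apply: bmfD; [exact: bmfB|exact: bmf_cst].
rewrite [X in `|X|](_ : _ = f (subst_coord j x (subst_coord k y' z1))
  - f (subst_coord k y' z1) - f (subst_coord j x z1) + f z1); last by lra.
exact: f_int.
Qed.

(** The part of the sum of conditional variances due to the coordinates in [s],
    seen from the remaining coordinates. *)
Definition tail_var (s : seq 'I_n) : n.-tuple T -> R :=
  Es s (fun z => \sum_(j <- s) dev j z ^+ 2).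

Lemma bmf_dev_sum (s : seq 'I_n) :
  bounded_measurable (fun z => \sum_(j <- s) dev j z ^+ 2).
Proof. by apply: bmf_sum => j; exact: bmf_sqr. Qed.
Local Hint Resolve bmf_dev_sum : core.

Lemma bmf_tail_var s : bounded_measurable (tail_var s).
Proof. exact: bmf_Es. Qed.
Local Hint Resolve bmf_tail_var : core.

Lemma tail_var_ge0 s z : 0 <= tail_var s z.
Proof.
by apply: Es_ge0 => // z'; apply: sumr_ge0 => j _; exact: sqr_ge0.
Qed.

Lemma size_le_n (s : seq 'I_n) : uniq s -> (size s <= n)%N.
Proof. by move=> /card_uniqP <-; rewrite -[leqRHS]card_ord max_card. Qed.

Lemma ord_natr_gt0 (k : 'I_n) : 0 < n%:R :> R.
Proof. by rewrite ltr0n (leq_ltn_trans _ (ltn_ord k)). Qed.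

Section oscillation.
Variables (s : seq 'I_n) (k : 'I_n) (y y' : T) (z : n.-tuple T).
Hypotheses (us : uniq s) (ks : k \notin s).

Let u j (z : n.-tuple T) := dev j (subst_coord k y z).
Let v j (z : n.-tuple T) := dev j (subst_coord k y' z).
Let S z := \sum_(j <- s) `|u j z + v j z|.

Let mu_ j : bounded_measurable (u j). Proof. exact: bmf_subst. Qed.
Let mv j : bounded_measurable (v j). Proof. exact: bmf_subst. Qed.

Let mS : bounded_measurable S.
Proof. by apply: bmf_sum => j; apply: bmf_norm; exact: bmfD. Qed.

Let diff_le : `|tail_var s (subst_coord k y z) - tail_var s (subst_coord k y' z)| <=
  Es s (fun z => b / n%:R * S z) z.
Proof.
rewrite /tail_var !Es_subst_notin//.
have mS2 w : bounded_measurable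
    (fun z => \sum_(j <- s) dev j (subst_coord k w z) ^+ 2).
  by apply: bmf_sum => j; apply: bmf_sqr; exact: bmf_subst.
have /(congr1 (@^~ z)) /= <- := EsB mu s (mS2 y) (mS2 y').
apply: le_trans (Es_norm _ _ _ _) _; first exact: bmfB.
apply: Es_le; [by apply: bmf_norm; exact: bmfB|exact: bmfZ|move=> w].
rewrite -sumrB mulr_sumr (le_trans (ler_norm_sum _ _ _))//.
rewrite big_seq [leRHS]big_seq; apply: ler_sum => j js.
rewrite subr_sqr normrM ler_wpM2r//.
by apply: dev_osc; apply: contraNneq ks => ->.
Qed.

Lemma tail_var_osc :
  `|tail_var s (subst_coord k y z) - tail_var s (subst_coord k y' z)| <= 2 * b ^+ 2.
Proof.
apply: (le_trans diff_le); rewrite -(Es_cst mu s (2 * b ^+ 2) z).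
apply: Es_le; [exact: bmfZ|exact: bmf_cst|move=> w].
have n0 := ord_natr_gt0 k.
rewrite mulrAC ler_pdivrMr//.
have -> : 2 * b ^+ 2 * n%:R = b * (2 * b * n%:R) by ring.
rewrite ler_wpM2l ?(ltW b0)//.
apply: (@le_trans _ _ (\sum_(j <- s) (2 * b))).
  apply: ler_sum => j _; apply: (le_trans (ler_normD _ _)).
  by rewrite mulr_natl mulr2n lerD//; exact: dev_le.
rewrite big_const_seq count_predT iter_addr addr0 -[_ *+ size s]mulr_natr.
by rewrite ler_wpM2l ?ler_nat ?size_le_n// mulr_ge0// ltW.
Qed.

(** The difference of two squared [L2] norms is the scalar product of the
    difference of the functions, which is at most [b / n] pointwise, with their
    sum; the Cauchy-Schwarz inequality bounds the latter by the norms. *)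
Lemma tail_var_self_bounding :
  (tail_var s (subst_coord k y z) - tail_var s (subst_coord k y' z)) ^+ 2 <=
  2 * b ^+ 2 / n%:R * (tail_var s (subst_coord k y z) + tail_var s (subst_coord k y' z)).
Proof.
have n0 := ord_natr_gt0 k.
rewrite -[leLHS]real_normK ?num_real//.
apply: (@le_trans _ _ (Es s (fun z => b / n%:R * S z) z ^+ 2)).
  by rewrite lerXn2r ?nnegrE// (le_trans _ diff_le).
apply: (le_trans (Es_jensen_sqr _ _ _ _)); first exact: bmfZ.
have mS2 w : bounded_measurable
    (fun z => \sum_(j <- s) dev j (subst_coord k w z) ^+ 2).
  by apply: bmf_sum => j; apply: bmf_sqr; exact: bmf_subst.
have mSS := bmfD (mS2 y) (mS2 y').
rewrite /tail_var !Es_subst_notin//.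
have /(congr1 (@^~ z)) /= <- := EsD mu s (mS2 y) (mS2 y').
have /(congr1 (@^~ z)) /= <- := EsZ mu s (2 * b ^+ 2 / n%:R) mSS.
apply: Es_le; [by apply: bmf_sqr; exact: bmfZ|exact: bmfZ|move=> w].
rewrite exprMn -big_split /=.
have S2 : S w ^+ 2 <= n%:R * \sum_(j <- s) (2 * (u j w ^+ 2 + v j w ^+ 2)).
  apply: (le_trans (sqr_sum_le _ _)).
  apply: ler_pM; rewrite ?ler_nat ?size_le_n//.
    by apply: sumr_ge0 => j _; exact: sqr_ge0.
  apply: ler_sum => j _; rewrite real_normK ?num_real//.
  rewrite -subr_ge0 (_ : _ - _ = (u j w - v j w) ^+ 2) ?sqr_ge0//; ring.
apply: (le_trans (ler_wpM2l _ S2)); first exact: sqr_ge0.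
rewrite -mulr_sumr le_eqVlt; apply/orP; left; apply/eqP.
by rewrite /u /v; field; rewrite gt_eqF.
Qed.

End oscillation.

Section induction.
Variables beta x : R.
Hypotheses (beta0 : 0 < beta) (xE : x = beta * b).
Hypothesis x_small : 32 * x <= 1.

Let x0 : 0 < x. Proof. by rewrite xE; exact: mulr_gt0. Qed.

Let x2 : 0 <= x * x /\ 32 * (x * x) <= x.
Proof.
have xp := ltW x0; split; first exact: mulr_ge0.
by rewrite mulrA ler_piMl.
Qed.

(** The exponent [theta] starts at [theta0] and grows by the relative amount
    [8 * x] in [n] equal steps.  The factor [1 + 2 * x] is that of
    [Eb_mgf_centered], since the exponents below are at most [2 * x], and
    [1 + 8 * x] that of [sqrD_weighted_le]. *)
Let theta0 := (1 + 2 * x) / 2 * ((1 + 8 * x) * beta ^+ 2).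
Let theta (m : nat) := theta0 * (1 + 8 * x * (m%:R / n%:R)).

Let theta0_gt0 : 0 < theta0.
Proof.
have xp := x0; have xs := x_small; rewrite /theta0; apply: mulr_gt0; first by lra.
by apply: mulr_gt0; [lra|exact: exprn_gt0].
Qed.

Let theta0_le : theta0 <= beta ^+ 2.
Proof.
have xp := x0; have xs := x_small; have [x2p x2s] := x2.
have c1 : (1 + 2 * x) / 2 * (1 + 8 * x) <= 1 by lra.
by rewrite /theta0 mulrA ler_piMl ?sqr_ge0.
Qed.

Let ratio01 m : (m <= n)%N -> 0 <= (m%:R / n%:R : R) <= 1.
Proof.
move=> mn; rewrite divr_ge0//=; case: (posnP n) => [->|n0].
  by rewrite invr0 mulr0.
by rewrite ler_pdivrMr ?ltr0n// mul1r ler_nat.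
Qed.

Let theta_ge0 m : (m <= n)%N -> theta0 <= theta m.
Proof.
have xp := x0; have xs := x_small; move=> /ratio01/andP[r0 _].
by rewrite /theta ler_pMr// lerDl mulr_ge0// mulr_ge0// ltW.
Qed.

Let theta_le m : (m <= n)%N -> theta m <= 5 / 4 * theta0.
Proof.
have xp := x0; have xs := x_small; move=> /ratio01/andP[r0 r1].
have x8 : 0 <= 8 * x by lra.
have xr := ler_wpM2l x8 r1.
have c1 : 1 + 8 * x * (m%:R / n%:R) <= 5 / 4 by lra.
by rewrite /theta mulrC ler_wpM2r ?(ltW theta0_gt0).
Qed.

(** The left-hand side adds to [theta m] the cost of the fluctuation of
    [tail_var]; it is of order [x ^ 2 / (8 * x)] relative to [theta0 / n], and the
    available increment is [8 * x]. *)
Let theta_step m : (m < n)%N ->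
  theta m + (1 + 2 * x) / 2 * ((1 + (8 * x)^-1) * theta m ^+ 2 * (4 * b ^+ 2 / n%:R))
  <= theta m.+1.
Proof.
move=> mn; have n0 : 0 < n%:R :> R by rewrite ltr0n (leq_ltn_trans _ mn).
have -> : theta m.+1 = theta m + theta0 * (8 * x / n%:R).
  by rewrite /theta -natr1; field; rewrite gt_eqF.
rewrite lerD2l.
have th2 : theta m ^+ 2 <= 25 / 16 * (beta ^+ 2 * theta0).
  apply: (@le_trans _ _ ((5 / 4 * theta0) ^+ 2)).
    rewrite lerXn2r ?nnegrE ?theta_le ?(ltnW mn)//.
      by rewrite (le_trans (ltW theta0_gt0))// theta_ge0// ltnW.
    by rewrite mulr_ge0// ltW.
  have := ler_wpM2r (ltW theta0_gt0) theta0_le.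
  by rewrite exprMn [theta0 ^+ 2]expr2; lra.
have c0 : 0 <= (1 + 2 * x) / 2 * (1 + (8 * x)^-1) * (4 * b ^+ 2 / n%:R).
  have xp := ltW x0; apply: mulr_ge0; first apply: mulr_ge0.
  - by lra.
  - by rewrite addr_ge0// invr_ge0 mulr_ge0.
  - by rewrite divr_ge0 ?(ltW n0)// mulr_ge0// sqr_ge0.
have := ler_wpM2l c0 th2.
set lhs := (X in X <= _); set rhs := (X in _ <= X -> _) => lr.
have -> : (1 + 2 * x) / 2 * ((1 + (8 * x)^-1) * theta m ^+ 2 * (4 * b ^+ 2 / n%:R))
    = lhs by rewrite /lhs; ring.
apply: (le_trans lr).
have -> : rhs = theta0 * (8 * x / n%:R) *
    ((1 + 2 * x) * (1 + 8 * x) * (25 / 512)).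
  rewrite /rhs xE; field.
  by rewrite !gt_eqF.
have c1 : (1 + 2 * x) * (1 + 8 * x) * (25 / 512) <= 1.
  by have xp := x0; have xs := x_small; have [x2p x2s] := x2; lra.
rewrite ler_piMr//; apply: mulr_ge0; first exact: ltW.
by rewrite divr_ge0 ?(ltW n0)// mulr_ge0// ltW.
Qed.

(** The variance proxy is transferred to the exponent one coordinate at a time.
    Averaging over [k] costs the conditional variance of [Es s f], which is at
    most the new summand of [tail_var (k :: s)], plus the fluctuation of
    [tail_var s]; by self-bounding the latter is a small multiple of [tail_var s]
    and is absorbed by the increment of [theta]. *)
Lemma Es_expR_le s z : uniq s ->
  Es s (fun z => expR (beta * f z)) z <=
  expR (beta * Es s f z + theta (size s) * tail_var s z).
Proof.
elim: s z => [|k s IH] z; first by rewrite /tail_var /= big_nil mulr0 addr0.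
rewrite [uniq _]/= => /andP[ks us].
have n0 := ord_natr_gt0 k.
have sn : (size s < n)%N.
  by apply: (size_le_n (s := k :: s)); rewrite /= ks.
have xp := x0; have xs := x_small; have [x2p x2s] := x2.
set F := Es s f; set G := tail_var s; set th := theta (size s).
have mF : bounded_measurable F by exact: bmf_Es.
have mG : bounded_measurable G by exact: bmf_tail_var.
have th_ge0 : 0 <= th by rewrite (le_trans (ltW theta0_gt0))// theta_ge0// ltnW.
set m1 := Ek k F z; set m2 := Ek k G z.
pose X y := beta * (F (subst_coord k y z) - m1) + th * (G (subst_coord k y z) - m2).
have mXF : bounded_measurable (fun y => F (subst_coord k y z) - m1).
  by apply: bmfB; [exact: bmf_fiber|exact: bmf_cst].
have mXG : bounded_measurable (fun y => G (subst_coord k y z) - m2).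
  by apply: bmfB; [exact: bmf_fiber|exact: bmf_cst].
have mX : bounded_measurable X by apply: bmfD; exact: bmfZ.
have FE y : F (subst_coord k y z) - m1 = Es s (dev k) (subst_coord k y z).
  have mEf : bounded_measurable (Ek k f) by exact: bmf_Ek.
  have /(congr1 (@^~ (subst_coord k y z))) /= := EsB mu s mf mEf.
  by rewrite /dev => ->; rewrite -EkEsC// Ek_subst.
have EX : \int[mu]_y X y = 0.
  rewrite EbD ?EbZ//; [|exact: bmfZ|exact: bmfZ].
  have -> : \int[mu]_y (F (subst_coord k y z) - m1) = 0.
    by apply: Eb_centered; exact: bmf_fiber.
  have -> : \int[mu]_y (G (subst_coord k y z) - m2) = 0.
    by apply: Eb_centered; exact: bmf_fiber.
  by rewrite !mulr0 addr0.
have Xle y : X y <= 2 * x.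
  have XF : F (subst_coord k y z) - m1 <= b.
    rewrite FE (le_trans (ler_norm _))// (le_trans (Es_norm _ _ _ _))//.
    rewrite -(Es_cst mu s b (subst_coord k y z)); apply: Es_le.
    - exact: bmf_norm.
    - exact: bmf_cst.
    - by move=> ?; exact: dev_le.
  have XG : G (subst_coord k y z) - m2 <= 2 * b ^+ 2.
    have -> : G (subst_coord k y z) - m2 =
        \int[mu]_y' (G (subst_coord k y z) - G (subst_coord k y' z)).
      by rewrite EbB ?Eb_cst//; [exact: bmf_cst|exact: bmf_fiber].
    apply: Eb_le_cst; first by apply: bmfB; [exact: bmf_cst|exact: bmf_fiber].
    by move=> y'; rewrite (le_trans (ler_norm _))// tail_var_osc.
  have thle : th <= 2 * beta ^+ 2.
    have := theta_le (ltnW sn); have := theta0_le; rewrite -/th.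
    have := sqr_ge0 beta; lra.
  have B1 : beta * (F (subst_coord k y z) - m1) <= x.
    by rewrite xE ler_wpM2l// ltW.
  have B2 : th * (G (subst_coord k y z) - m2) <= 2 * beta ^+ 2 * (2 * b ^+ 2).
    apply: (le_trans (ler_wpM2l th_ge0 XG)).
    by rewrite ler_wpM2r// mulr_ge0// sqr_ge0.
  have -> : 2 * x = x + x by ring.
  apply: lerD => //; apply: (le_trans B2).
  have -> : 2 * beta ^+ 2 * (2 * b ^+ 2) = x * (4 * x) by rewrite xE; ring.
  by rewrite ler_piMr ?(ltW x0)//; lra.
set p := Ek k (Es s (fun z => dev k z ^+ 2)) z.
have VF : \int[mu]_y (F (subst_coord k y z) - m1) ^+ 2 <= p.
  apply: Eb_le; first exact: bmf_sqr.
    by apply: bmf_fiber; apply: bmf_Es; exact: bmf_sqr.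
  by move=> y; rewrite FE Es_jensen_sqr.
have VG : \int[mu]_y (G (subst_coord k y z) - m2) ^+ 2 <=
    4 * b ^+ 2 / n%:R * m2.
  have -> : 4 * b ^+ 2 / n%:R = 2 * (2 * b ^+ 2 / n%:R) by ring.
  apply: Eb_self_bounding; first exact: bmf_fiber.
  by move=> y y'; exact: tail_var_self_bounding.
have WE : tail_var (k :: s) z = p + m2.
  rewrite /tail_var /=.
  under eq_fun do rewrite big_cons.
  rewrite EsD//; last exact: bmf_sqr.
  by rewrite /cond_exp EbD//; apply: bmf_fiber; apply: bmf_Es => //; exact: bmf_sqr.
have p_ge0 : 0 <= p.
  apply: Rintegral_ge0 => y _; apply: Es_ge0; first exact: bmf_sqr.
  by move=> ?; exact: sqr_ge0.
have m2_ge0 : 0 <= m2 by apply: Rintegral_ge0 => y _; exact: tail_var_ge0.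
have VX : \int[mu]_y X y ^+ 2 <= (1 + 8 * x) * beta ^+ 2 * p +
    (1 + (8 * x)^-1) * th ^+ 2 * (4 * b ^+ 2 / n%:R * m2).
  have mX1 := bmfZ ((1 + 8 * x) * beta ^+ 2) (bmf_sqr mXF).
  have mX2 := bmfZ ((1 + (8 * x)^-1) * th ^+ 2) (bmf_sqr mXG).
  have e0 : 0 < 8 * x by rewrite mulr_gt0.
  apply: (@le_trans _ _ (\int[mu]_y
      ((1 + 8 * x) * beta ^+ 2 * (F (subst_coord k y z) - m1) ^+ 2 +
      (1 + (8 * x)^-1) * th ^+ 2 * (G (subst_coord k y z) - m2) ^+ 2))).
    apply: Eb_le; [exact: bmf_sqr|exact: bmfD|move=> y].
    have := sqrD_weighted_le (beta * (F (subst_coord k y z) - m1))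
      (th * (G (subst_coord k y z) - m2)) e0.
    by rewrite !exprMn !mulrA.
  rewrite EbD// !EbZ//; [|exact: bmf_sqr|exact: bmf_sqr].
  apply: lerD; apply: ler_wpM2l => //; apply: mulr_ge0; rewrite ?sqr_ge0//.
    by rewrite addr_ge0// ltW.
  by rewrite addr_ge0// invr_ge0 ltW.
apply: (@le_trans _ _ (\int[mu]_y (expR (beta * m1 + th * m2) * expR (X y)))).
  apply: Eb_le.
  - have mE : bounded_measurable (Es s (fun z => expR (beta * f z))).
      by apply: bmf_Es; apply: bmf_exp; exact: bmfZ.
    exact: bmf_fiber.
  - by apply: bmfZ; exact: bmf_exp.
  - move=> y; apply: (le_trans (IH _ us)); rewrite -expRD ler_expR /X -/F -/G -/th.
    lra.
rewrite EbZ; last exact: bmf_exp.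
have mgf : \int[mu]_y expR (X y) <= expR ((1 + 2 * x) / 2 * \int[mu]_y X y ^+ 2).
  by apply: Eb_mgf_centered => //; lra.
apply: (le_trans (ler_wpM2l (expR_ge0 _) mgf)).
rewrite -expRD ler_expR WE /= -/m1.
have step := ler_wpM2r m2_ge0 (theta_step sn).
have step1 := ler_wpM2r p_ge0 (theta_ge0 sn).
have c0 : 0 <= (1 + 2 * x) / 2 by lra.
have := ler_wpM2l c0 VX.
rewrite -/F -/m1; move: step step1; rewrite -/th /theta0; lra.
Qed.

End induction.

End interaction.
(** * A Bernstein inequality for functions with small interactions *)

Section bernstein.
Context d (T : measurableType d) (R : realType) (mu : probability T R) (n : nat).
Context d' (Omega : measurableType d') (P : probability Omega R).
Variable bZ : Omega -> n.-tuple T.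
Hypotheses (n_gt0 : (0 < n)%N) (mbZ : measurable_fun setT bZ).

Local Notation Ek := (@cond_exp _ _ _ mu setT n).
Local Notation Es := (@Es _ _ _ mu n).

Hypothesis resample : forall k g, bounded_measurable g ->
  \int[P]_w Ek k g (bZ w) = \int[P]_w g (bZ w).

(** Once all coordinates are averaged out nothing is left to depend on. *)
Lemma Es_expectation g z : bounded_measurable g ->
  Es (enum 'I_n) g z = \int[P]_w g (bZ w).
Proof.
move=> mg.
have <- : \int[P]_w Es (enum 'I_n) g (bZ w) = \int[P]_w g (bZ w).
  elim: (enum _) => //= k s <-; rewrite resample//; exact: bmf_Es.
have cst z' : Es (enum 'I_n) g z' = Es (enum 'I_n) g z.
  apply: subst_invariant_cst => k y z0.
  by apply: Es_subst => //; rewrite mem_enum.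
by under eq_Rintegral do rewrite cst; rewrite Eb_cst.
Qed.

Variables (f : n.-tuple T -> R) (b : R).
Hypothesis b0 : 0 < b.
Hypothesis mf : bounded_measurable f.
Hypothesis f_osc : forall k y z, `|f (subst_coord k y z) - f z| <= b.
Hypothesis f_int : forall k l y y' z, k != l ->
  `|f (subst_coord l y' (subst_coord k y z)) - f (subst_coord k y z)
    - f (subst_coord l y' z) + f z| <= b / n%:R.

Let m := \int[P]_w f (bZ w).
Let V := \int[P]_w sum_cond_var mu setT f (bZ w).

Let V_ge0 : 0 <= V.
Proof.
apply: Rintegral_ge0 => w _; apply: sumr_ge0 => k _.
by apply: Rintegral_ge0 => y _; exact: sqr_ge0.
Qed.

Let mfZ : bounded_measurable (fun w => f (bZ w)).
Proof. exact: bmf_comp mbZ. Qed.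

Lemma tail_var_expectation z : tail_var mu f (enum 'I_n) z = V.
Proof.
have mdev k := bmf_sqr (bmf_dev mu mf k).
rewrite /tail_var Es_expectation; last exact: bmf_sum.
rewrite Eb_sum; last by move=> k; exact: (bmf_comp (mdev k) mbZ).
rewrite (eq_bigr (fun k => \int[P]_w cond_var mu setT k f (bZ w))); last first.
  by move=> k _; exact/esym/(resample k (mdev k)).
rewrite -Eb_sum; last first.
  by move=> k; exact: (bmf_comp (bmf_Ek mu k (mdev k)) mbZ).
by apply: eq_Rintegral => w _; rewrite /sum_cond_var big_enum.
Qed.

(** The constant 32 absorbs the three correction factors
    [(1 + 2 * x) * (1 + 8 * x) ^+ 2] of the exponent. *)
Lemma mgf_bernstein_le (beta : R) : 0 < beta -> 32 * (beta * b) <= 1 ->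
  \int[P]_w expR (beta * f (bZ w)) <=
  expR (beta * m + (1 + 32 * (beta * b)) * beta ^+ 2 * V / 2).
Proof.
move=> beta0 xs.
have me : bounded_measurable (fun z => expR (beta * f z)).
  by apply: bmf_exp; exact: bmfZ.
have [w0] : exists w : Omega, True.
  apply: contrapT => /forallNP noW.
  have : P setT = 1%E by exact: probability_setT.
  rewrite (_ : setT = set0) ?measure0 => [/eqP|]; first by rewrite eq_sym onee_eq0.
  by apply/seteqP; split => // w; case: (noW w).
move=> _; rewrite -(Es_expectation (bZ w0) me).
apply: (le_trans (Es_expR_le mu b0 mf f_osc f_int beta0 erefl xs (bZ w0) (enum_uniq _))).
rewrite tail_var_expectation Es_expectation// ler_expR lerD2l size_enum_ord.
have n0 : n%:R != 0 :> R by rewrite pnatr_eq0 -lt0n.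
rewrite divff// mulr1.
set x := beta * b in xs *.
have x0 : 0 < x by exact: mulr_gt0.
have bV : 0 <= beta ^+ 2 * V by rewrite mulr_ge0// sqr_ge0.
have x2 : 32 * (x * x) <= x by rewrite mulrA ler_piMl// ltW.
have x3 : 32 * (x * (x * x)) <= x * x by rewrite mulrA ler_piMl// mulr_ge0// ltW.
have cle : (1 + 2 * x) / 2 * (1 + 8 * x) * (1 + 8 * x) <= (1 + 32 * x) / 2 by lra.
have := ler_wpM2r bV cle; lra.
Qed.

(** Markov's inequality for [expR (beta * f)], with [beta] the usual near-optimal
    choice [t / (V + 32 b t)], for which [32 * (beta * b) <= 1] automatically. *)
Lemma bernstein_interaction (t : R) : 0 < t ->
  (P [set w | (t < f (bZ w) - m)%R] <=
   (expR (- t ^+ 2 / (2 * V + 64 * b * t)))%:E)%E.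
Proof.
move=> t0; pose D := V + 32 * (b * t).
have bt0 : 0 < b * t by exact: mulr_gt0.
have D0 : 0 < D by rewrite ltr_wpDl// mulr_gt0.
pose beta := t / D.
have beta0 : 0 < beta by exact: divr_gt0.
have xs : 32 * (beta * b) <= 1.
  by rewrite (_ : _ * _ = 32 * (b * t) / D) ?ler_pdivrMr ?mul1r ?lerDr// /beta; ring.
have mE : bounded_measurable (fun w => expR (beta * f (bZ w))).
  by apply: bmf_exp; exact: bmfZ.
pose A := [set w | t < f (bZ w) - m].
have mA : measurable A.
  rewrite -[A]setTI; apply: measurable_fun_ltr => //.
  by apply: measurable_funB => //; case: mfZ.
set c := expR (- (beta * (m + t))).
have -> : P A = (\int[P]_w (\1_A w)%:E)%E by rewrite integral_indic// setIT.
apply: (@le_trans _ _ (\int[P]_w (c * expR (beta * f (bZ w)))%:E)%E).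
  have mcE := bmfZ c mE.
  apply: ge0_le_integral => //.
  - by apply/measurable_EFinP; exact: measurable_indic.
  - by apply/measurable_EFinP; case: mcE.
  - move=> w _; rewrite lee_fin indicE; case: (boolP (w \in A)) => [|_].
      rewrite inE /A /= => tw; rewrite /c -expRD -[leLHS]expR0 ler_expR.
      by rewrite addrC -mulrBr mulr_ge0 ?(ltW beta0)//; lra.
    by rewrite mulr_ge0// expR_ge0.
have -> : (\int[P]_w (c * expR (beta * f (bZ w)))%:E)%E =
    (c * \int[P]_w expR (beta * f (bZ w)))%:E.
  rewrite -EbZ// /Rintegral fineK//; apply: integrable_fin_num => //.
  by apply: bmf_integrable; exact: bmfZ.
rewrite lee_fin.
apply: (le_trans (ler_wpM2l (expR_ge0 _) (mgf_bernstein_le beta0 xs))).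
rewrite /c -expRD ler_expR.
have -> : - (beta * (m + t)) +
    (beta * m + (1 + 32 * (beta * b)) * beta ^+ 2 * V / 2) =
    - (beta * t) + (1 + 32 * (beta * b)) * beta ^+ 2 * V / 2 by ring.
have -> : - t ^+ 2 / (2 * V + 64 * b * t) = - (beta * t) / 2.
  rewrite (_ : 2 * V + 64 * b * t = 2 * D); last by rewrite /D; ring.
  by rewrite /beta; field; rewrite gt_eqF.
suff : (1 + 32 * (beta * b)) * (beta * V) <= t.
  by move=> /(ler_wpM2l (ltW beta0)); lra.
have -> : (1 + 32 * (beta * b)) * (beta * V) =
    t * ((V * D + 32 * (b * t) * V) / D ^+ 2).
  by rewrite /beta; field; rewrite gt_eqF.
rewrite ger_pMr// ler_pdivrMr ?exprn_gt0// mul1r -subr_ge0.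
have -> : D ^+ 2 - (V * D + 32 * (b * t) * V) = (32 * (b * t)) ^+ 2.
  by rewrite /D; ring.
exact: sqr_ge0.
Qed.

End bernstein.
(** * Resampling one coordinate of an independent sample *)

Section law.
Context d (Y : measurableType d) (R : realType).
Context d1 (X1 : measurableType d1) d2 (X2 : measurableType d2).
Variables (P1 : probability X1 R) (P2 : probability X2 R).
Variables (phi1 : X1 -> Y) (phi2 : X2 -> Y).
Hypotheses (m1 : measurable_fun setT phi1) (m2 : measurable_fun setT phi2).

(** Dynkin's theorem in the form used for independence: laws that agree on a
    generating pi-system give the same expectations. *)
Lemma eq_law_pi_system (G : set (set Y)) : measurable = <<s G >> ->
  setI_closed G -> G setT ->
  (forall A, G A -> P1 (phi1 @^-1` A) = P2 (phi2 @^-1` A)) ->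
  forall g, bounded_measurable g ->
  \int[P1]_x g (phi1 x) = \int[P2]_x g (phi2 x).
Proof.
move=> GE GI GT PG g mg.
pose f1 : {mfun X1 >-> Y} := HB.pack phi1 (isMeasurableFun.Build _ _ _ _ phi1 m1).
pose f2 : {mfun X2 >-> Y} := HB.pack phi2 (isMeasurableFun.Build _ _ _ _ phi2 m2).
rewrite /Rintegral; congr fine.
have mgE : measurable_fun setT (EFin \o g) by apply/measurable_EFinP; case: mg.
have i1 : P1.-integrable setT ((EFin \o g) \o f1).
  by apply: bmf_integrable; exact: bmf_comp m1.
have i2 : P2.-integrable setT ((EFin \o g) \o f2).
  by apply: bmf_integrable; exact: bmf_comp m2.
rewrite -(integral_distribution mgE i1) -(integral_distribution mgE i2).
apply: eq_measure_integral => A mA _.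
apply: (measure_unique G (fun=> setT)) => //.
  by rewrite bigcup_const.
by move=> _; rewrite /= probability_setT ltry.
Qed.

End law.

Section rectangles.
Context d (T : measurableType d) (n : nat).

Definition rectangles : set (set (n.-tuple T)) :=
  [set B | exists2 A : 'I_n -> set T, (forall i, measurable (A i)) &
    B = [set z | forall i, A i (tnth z i)]].

Lemma rectangles_setT : rectangles setT.
Proof. by exists (fun=> setT) => //; apply/seteqP; split. Qed.

Lemma rectangles_setI : setI_closed rectangles.
Proof.
move=> _ _ [A mA ->] [B mB ->]; exists (fun i => A i `&` B i).
  by move=> i; exact: measurableI.
by apply/seteqP; split=> z /= => [[zA zB] i|zAB]; [|split=> i; case: (zAB i)].
Qed.

Lemma measurable_rectangle (A : 'I_n -> set T) : (forall i, measurable (A i)) ->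
  measurable [set z : n.-tuple T | forall i, A i (tnth z i)].
Proof.
move=> mA.
rewrite (_ : mkset _ = \bigcap_(i in [set: 'I_n]) ((@tnth _ T ^~ i) @^-1` A i)).
  apply: fin_bigcap_measurable => // i _.
  by rewrite -[X in measurable X]setTI; exact: measurable_tnth.
by apply/seteqP; split=> z /= zA i; [move=> _; exact: zA|exact: zA].
Qed.

Lemma rectangles_generate :
  @measurable _ (n.-tuple T) = <<s rectangles >>.
Proof.
apply/seteqP; split.
  apply: sub_smallest2r; first exact: smallest_sigma_algebra.
  rewrite -bigcup_seq => B [i _ [A mA <-]] /=.
  exists (fun j => if j == i then A else setT) => [j|]; first by case: ifP.
  apply/seteqP; split=> z /= => [[_ zA] j|zA].
    by case: eqP => [->|].
  by split=> //; move: (zA i); rewrite eqxx.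
apply: smallest_sub; first exact: sigma_algebra_measurable.
by move=> _ [A mA ->]; exact: measurable_rectangle.
Qed.

End rectangles.

Section resampling.
Context d (T : measurableType d) (R : realType) (n : nat).
Context d' (Omega : measurableType d').
Variables (P : probability Omega R) (mu : probability T R).
Variable Z : 'I_n -> {RV P >-> T}.
Hypothesis indep : mutually_independent P Z.
Hypothesis ident : forall i (A : set T), measurable A ->
  distribution P (Z i) A = mu A.

Let bZ (w : Omega) : n.-tuple T := [tuple Z i w | i < n].

Lemma measurable_sample : measurable_fun setT bZ.
Proof.
apply/measurable_fun_tnthP => i.
rewrite (_ : _ \o _ = Z i); first exact: measurable_funPT.
by apply/funext => w /=; rewrite tnth_mktuple.
Qed.

(** Both sides integrate against the same law on tuples: by independence the two
    laws agree on rectangles. *)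
Lemma resample_sample k g : bounded_measurable g ->
  \int[P]_w cond_exp mu setT k g (bZ w) = \int[P]_w g (bZ w).
Proof.
move=> mg; pose phi (p : Omega * T) := subst_coord k p.2 (bZ p.1).
have mphi : measurable_fun setT phi.
  have mZ1 : measurable_fun setT (fun p : Omega * T => bZ p.1).
    exact: (measurableT_comp measurable_sample measurable_fst).
  exact: (measurableT_comp (measurable_subst k)
    (measurable_fun_pair mZ1 measurable_snd)).
have mgphi : bounded_measurable (fun p => g (phi p)) by exact: bmf_comp mphi.
have <- : fine (\int[P \x mu]_p (g (phi p))%:E)%E =
    \int[P]_w cond_exp mu setT k g (bZ w).
  by rewrite (Rintegral_prod P mu mgphi).
apply: (eq_law_pi_system (P1 := [the probability _ _ of (P \x mu)%E]) mphi
  measurable_sample (@rectangles_generate _ T n)) => //.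
- exact: rectangles_setI.
- exact: rectangles_setT.
move=> _ [A mA ->].
have mZ i : measurable (Z i @^-1` A i).
  by rewrite -[X in measurable X]setTI; exact: measurable_funPT.
have PZ i : P (Z i @^-1` A i) = mu (A i) by rewrite -(ident i).
pose B := \bigcap_(i in [set i | i \in ~: [set k]%SET]) (Z i @^-1` A i).
have -> : phi @^-1` [set z | forall i, A i (tnth z i)] = B `*` A k.
  apply/seteqP; split=> -[w y] /=.
    move=> wA; split; last by have := wA k; rewrite tnth_subst eqxx.
    move=> i /=; rewrite !inE => ik.
    by have := wA i; rewrite tnth_subst (negbTE ik) tnth_mktuple.
  move=> [wB yA] i; rewrite tnth_subst; case: eqP => [->//|/eqP ik].
  by rewrite tnth_mktuple; apply: wB => /=; rewrite !inE.
have mB : measurable B by apply: fin_bigcap_measurable => // i _.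
transitivity ((P \x mu)%E (B `*` A k)); first by [].
rewrite product_measure1E//=.
have -> : bZ @^-1` [set z | forall i, A i (tnth z i)] =
    \bigcap_(i in [set i | i \in [set: 'I_n]%SET]) (Z i @^-1` A i).
  apply/seteqP; split=> w /= wA i; first by have := wA i; rewrite tnth_mktuple.
  by rewrite tnth_mktuple; apply: wA; rewrite /= inE.
rewrite !indep//.
rewrite [in RHS](bigD1 k) ?inE//= muleC PZ; congr (_ * _)%E.
by apply: eq_bigl => i; rewrite !inE.
Qed.

End resampling.
(** * Regularized least squares *)

Section inner_product.
Context (R : realType) (H : completeNormedModType R) (ip : {dot H for idfun}).
Hypothesis ipN : induces_norm ip.
Implicit Types (u v w : H) (c : R).

Lemma ipC u v : ip u v = ip v u.
Proof. by rewrite hermitian_subproof expr0 mul1r. Qed.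

Lemma ipDl u v w : ip (u + v) w = ip u w + ip v w.
Proof. exact: linearDl. Qed.

Lemma ipDr u v w : ip u (v + w) = ip u v + ip u w.
Proof. exact: linearDr. Qed.

Lemma ipBl u v w : ip (u - v) w = ip u w - ip v w.
Proof. exact: linearBl. Qed.

Lemma ipBr u v w : ip u (v - w) = ip u v - ip u w.
Proof. exact: linearBr. Qed.

Lemma ipZl c u v : ip (c *: u) v = c * ip u v.
Proof. exact: linearZl_LR. Qed.

Lemma ip0l v : ip 0 v = 0.
Proof. exact: linear0l. Qed.

Lemma ip_suml (I : Type) (s : seq I) (F : I -> H) v :
  ip (\sum_(i <- s) F i) v = \sum_(i <- s) ip (F i) v.
Proof. exact: linear_sumlz. Qed.

Lemma ip_le u v : ip u v <= `|u| * `|v|.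
Proof.
have [->|u0] := eqVneq u 0; first by rewrite ip0l normr0 mul0r.
have [->|v0] := eqVneq v 0; first by rewrite ipC ip0l normr0 mulr0.
have uv0 : 0 < `|u| * `|v| by rewrite mulr_gt0 ?normr_gt0.
have : 0 <= ip (`|v| *: u - `|u| *: v) (`|v| *: u - `|u| *: v).
  by rewrite ipN sqr_ge0.
rewrite ipBl !ipBr !ipZl ![ip _ (_ *: _)]ipC !ipZl (ipC v u) !ipN => h.
rewrite -(ler_pM2l uv0); nra.
Qed.

Lemma cauchy_schwarz u v : `|ip u v| <= `|u| * `|v|.
Proof.
rewrite ler_norml ip_le andbT lerNl -mulN1r -ipZl scaleN1r.
by rewrite (le_trans (ip_le _ _))// normrN.
Qed.

(** Adding a rank-one term keeps the equation solvable, by the Sherman-Morrison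
    formula; this gives a minimizer without a compactness argument. *)
Lemma regularized_solvable c (s : seq H) v : 0 < c ->
  exists u, c *: u + \sum_(x <- s) ip u x *: x = v.
Proof.
move=> c0; elim: s v => [|x s IH] v.
  by exists (c^-1 *: v); rewrite big_nil addr0 scalerA divff ?scale1r// gt_eqF.
have [uv uvE] := IH v; have [ux uxE] := IH x.
have ux0 : 0 <= ip ux x.
  rewrite -[in X in ip ux X]uxE ipC ipDl ipZl ip_suml.
  rewrite addr_ge0//; first by rewrite mulr_ge0 ?ipN ?sqr_ge0// ltW.
  by apply: sumr_ge0 => y _; rewrite ipZl (ipC y) -expr2 sqr_ge0.
have d0 : 1 + ip ux x != 0 by rewrite gt_eqF// ltr_pwDl.
set a := ip uv x / (1 + ip ux x).
exists (uv - a *: ux); rewrite big_cons.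
have -> : \sum_(y <- s) ip (uv - a *: ux) y *: y =
    \sum_(y <- s) ip uv y *: y - a *: \sum_(y <- s) ip ux y *: y.
  rewrite scaler_sumr -sumrB; apply: eq_bigr => y _.
  by rewrite ipBl ipZl scalerBl scalerA.
have -> : c *: (uv - a *: ux) = c *: uv - a *: (c *: ux).
  by rewrite scalerBr !scalerA mulrC.
have aE : ip (uv - a *: ux) x = a.
  by rewrite ipBl ipZl /a; field.
rewrite aE addrCA addrACA uvE -opprD -scalerDr uxE.
by rewrite addrC subrK.
Qed.

End inner_product.

Lemma scale_second_difference (R : nzRingType) (V : lmodType R) (a c : R)
    (u1 u2 u3 u4 v1 v2 v3 v4 : V) :
  (a *: u1 + c *: v1) - (a *: u2 + c *: v2) - (a *: u3 + c *: v3) +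
    (a *: u4 + c *: v4) =
  a *: (u1 - u2 - u3 + u4) + c *: (v1 - v2 - v3 + v4).
Proof.
have pairB (x y x' y' : V) : (x + y) - (x' + y') = (x - x') + (y - y').
  by rewrite opprD addrACA.
by rewrite !scalerDr !scalerN [X in X - _ + _ = _]pairB pairB addrACA.
Qed.

Lemma scale_collect (R : nzRingType) (V : lmodType R) (a b c d e : R) (u v : V) :
  a *: u - b *: u - c *: v + d *: v - e *: v = (a - b) *: u + (d - c - e) *: v.
Proof. by rewrite !scalerBl [X in X - e *: v]addrAC !addrA. Qed.

Section least_squares.
Context (R : realType) (H : completeNormedModType R) (ip : {dot H for idfun}).
Hypothesis ipN : induces_norm ip.
Variables (lam r : R) (n : nat).
Hypotheses (lam0 : 0 < lam) (lam1 : lam < 1) (r0 : 0 < r) (lamr : lam * r ^+ 2 = 1).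
Hypothesis n_gt0 : (0 < n)%N.
Local Notation Ex := (example H R).
Local Notation D := (@sample_space R H).
Implicit Types (z : n.-tuple Ex) (w h : H) (p : Ex).

Definition residual w p : R := ip w p.1 - p.2.

Definition feature p : H := p.1.

Definition loss_grad w p : H := residual w p *: feature p.

(** Half the gradient of the objective. *)
Definition grad z w : H :=
  lam *: w + n%:R^-1 *: \sum_(i < n) loss_grad w (tnth z i).

Let n0 : 0 < n%:R :> R. Proof. by rewrite ltr0n. Qed.

Lemma grad_eq0_solvable z : exists w, grad z w = 0.
Proof.
have nl : 0 < n%:R * lam by exact: mulr_gt0.
have [w wE] := @regularized_solvable R H ip ipN _ [seq feature p | p <- z]
  (\sum_(i < n) (tnth z i).2 *: feature (tnth z i)) nl.
exists w; rewrite /grad.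
have -> : lam *: w = n%:R^-1 *: ((n%:R * lam) *: w).
  by rewrite scalerA mulrA mulVf ?mul1r// gt_eqF.
rewrite -scalerDr; apply/eqP; rewrite scaler_eq0; apply/orP; right.
under eq_bigr do rewrite /loss_grad /residual scalerBl.
rewrite sumrB addrA -wE big_map big_tuple.
by rewrite subr_eq0.
Qed.

(** The objective is quadratic, so its second-order expansion is exact. *)
Lemma objectiveD z w h : rls_objective ip lam z (w + h) =
  rls_objective ip lam z w + 2 * ip (grad z w) h +
  (n%:R^-1 * \sum_(i < n) ip h (feature (tnth z i)) ^+ 2 + lam * `|h| ^+ 2).
Proof.
rewrite /rls_objective /empirical_risk /grad ipDl !ipZl ip_suml.
rewrite -!ipN ipDl !ipDr (ipC ip h w).
have -> : \sum_(i < n) square_loss ip (w + h) (tnth z i) =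
    \sum_(i < n) square_loss ip w (tnth z i) +
    2 * (\sum_(i < n) ip (loss_grad w (tnth z i)) h) +
    \sum_(i < n) ip h (feature (tnth z i)) ^+ 2.
  rewrite mulr_sumr -!big_split /=; apply: eq_bigr => i _.
  rewrite /square_loss /loss_grad /residual /feature ipDl ipZl [ip (tnth z i).1 h]ipC.
  ring.
ring.
Qed.

(** By the expansion around a zero of the gradient, that zero is the only
    minimizer; hence it is the one chosen by [rls]. *)
Lemma rls_grad z : grad z (rls ip lam z) = 0.
Proof.
have [w wE] := grad_eq0_solvable z.
have key h : rls_objective ip lam z w + lam * `|h| ^+ 2 <=
    rls_objective ip lam z (w + h).
  rewrite objectiveD wE ip0l mulr0 addr0 lerD2l lerDr mulr_ge0 ?invr_ge0//.
  by apply: sumr_ge0 => i _; exact: sqr_ge0.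
have wmin : [set w | forall v, rls_objective ip lam z w <= rls_objective ip lam z v] w.
  move=> v; rewrite -[v](subrKC w); apply: le_trans (key _).
  by rewrite lerDl mulr_ge0 ?sqr_ge0// ltW.
have := xgetI 0 wmin; rewrite -/(rls ip lam z) /= => /(_ w).
set v := rls ip lam z.
have := key (v - w); rewrite subrKC => k1 k2.
have : lam * `|v - w| ^+ 2 <= 0 by lra.
rewrite pmulr_rle0// => v2; have : `|v - w| ^+ 2 == 0 by rewrite eq_le v2 sqr_ge0.
by rewrite sqrf_eq0 normr_eq0 subr_eq0 => /eqP ->.
Qed.

Lemma rls_min z v : rls_objective ip lam z (rls ip lam z) <= rls_objective ip lam z v.
Proof.
rewrite -[v](subrKC (rls ip lam z)) objectiveD rls_grad ip0l mulr0 addr0 lerDl.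
rewrite addr_ge0// mulr_ge0 ?invr_ge0 ?sqr_ge0 ?(ltW lam0)//.
by apply: sumr_ge0 => i _; exact: sqr_ge0.
Qed.

(** The scalar product of the right-hand vector with [h] is at least
    [lam * `|h| ^+ 2]; here and below [r ^+ 2] is the inverse of [lam]. *)
Lemma coercive z h :
  `|h| <= r ^+ 2 *
    `|lam *: h + n%:R^-1 *: \sum_(i < n) ip h (feature (tnth z i)) *: feature (tnth z i)|.
Proof.
set g := (_ + _).
have hg : lam * `|h| ^+ 2 <= `|g| * `|h|.
  apply: le_trans (ip_le ipN g h).
  rewrite /g ipDl !ipZl ip_suml ipN lerDl mulr_ge0 ?invr_ge0//.
  by apply: sumr_ge0 => i _; rewrite ipZl [ip _ h]ipC -expr2 sqr_ge0.
have [->|h0] := eqVneq h 0; first by rewrite normr0 mulr_ge0 ?sqr_ge0.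
have {}hg : lam * `|h| <= `|g|.
  by rewrite -(ler_pM2r (_ : 0 < `|h|)) ?normr_gt0// -mulrA -expr2.
have := ler_wpM2l (sqr_ge0 r) hg.
by rewrite mulrA [r ^+ 2 * lam]mulrC lamr mul1r.
Qed.

Lemma r_ge1 : 1 <= r.
Proof.
rewrite leNgt; apply/negP => r1.
have : lam * r ^+ 2 < 1; last by rewrite lamr ltxx.
have := r0; have := lam0; have := lam1; move=> l1 l0 r0'.
rewrite (le_lt_trans _ l1)// ler_piMr ?(ltW l0)// expr_le1 ?ltW//.
Qed.

Definition in_space z := forall i, D (tnth z i).

Definition dist p p' : R := `|feature p - feature p'| + `|p.2 - p'.2|.

Lemma dist_ge0 p p' : 0 <= dist p p'.
Proof. exact: addr_ge0. Qed.

Lemma dist_le4 p p' : D p -> D p' -> dist p p' <= 4.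
Proof.
move=> [x1 /andP[y1 y2]] [x1' /andP[y1' y2']].
rewrite (_ : 4 = 1 + 1 + 2)// /dist; last by ring.
apply: lerD; first by rewrite (le_trans (ler_normB _ _))// lerD.
by rewrite ler_norml; apply/andP; split; lra.
Qed.

(** The objective at the minimizer is at most its value at 0, which is at most
    1. *)
Lemma rls_norm z : in_space z -> `|rls ip lam z| <= r.
Proof.
move=> zD; have := rls_min z 0; rewrite {2}/rls_objective normr0 expr0n mulr0 addr0.
move=> J.
have e0 : empirical_risk ip z 0 <= 1.
  rewrite /empirical_risk mulrC ler_pdivrMr// mul1r.
  apply: (@le_trans _ _ (\sum_(i < n) 1)); last first.
    by rewrite big_const_ord iter_addr addr0.
  apply: ler_sum => i _; rewrite /square_loss ip0l sub0r sqrrN.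
  by have [_ /andP[y1 y2]] := zD i; nra.
have ew : 0 <= empirical_risk ip z (rls ip lam z).
  rewrite /empirical_risk mulr_ge0 ?invr_ge0//.
  by apply: sumr_ge0 => i _; exact: sqr_ge0.
have l1 : lam * `|rls ip lam z| ^+ 2 <= 1.
  by move: J; rewrite /rls_objective; lra.
rewrite -(@ler_pXn2r _ 2)// ?nnegrE// ?(ltW r0)//.
by rewrite -(ler_pM2l lam0) lamr.
Qed.

Lemma residual_le w p : `|w| <= r -> D p -> `|residual w p| <= 2 * r.
Proof.
move=> wr [x1 /andP[y1 y2]]; rewrite /residual.
apply: (le_trans (ler_normB _ _)).
have y : `|p.2| <= 1 by rewrite ler_norml y1.
have x : `|ip w p.1| <= r.
  apply: (le_trans (cauchy_schwarz ipN _ _)).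
  by rewrite -[leRHS]mulr1 ler_pM.
have := r_ge1; lra.
Qed.

Lemma residual_dist w p p' : `|w| <= r ->
  `|residual w p - residual w p'| <= r * dist p p'.
Proof.
move=> wr; rewrite /residual.
have -> : ip w p.1 - p.2 - (ip w p'.1 - p'.2) =
    ip w (feature p - feature p') - (p.2 - p'.2) by rewrite ipBr; ring.
apply: (le_trans (ler_normB _ _)); rewrite /dist mulrDr lerD//.
  by rewrite (le_trans (cauchy_schwarz ipN _ _))// ler_wpM2r.
by rewrite ler_peMl// r_ge1.
Qed.

Lemma loss_grad_dist w p p' : `|w| <= r -> D p -> D p' ->
  `|loss_grad w p - loss_grad w p'| <= 3 * r * dist p p'.
Proof.
move=> wr pD p'D; rewrite /loss_grad.
have -> : residual w p *: feature p - residual w p' *: feature p' =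
    (residual w p - residual w p') *: feature p +
    residual w p' *: (feature p - feature p').
  by rewrite [in RHS]scalerBl scalerBr addrA subrK.
apply: (le_trans (ler_normD _ _)); rewrite !normrZ.
have -> : 3 * r * dist p p' = r * dist p p' * 1 + 2 * r * dist p p' by ring.
apply: lerD; apply: ler_pM => //; [exact: residual_dist|by case: pD|exact: residual_le|].
by rewrite /dist lerDl.
Qed.

Definition mean_dist z z' : R :=
  n%:R^-1 * \sum_(i < n) dist (tnth z i) (tnth z' i).

Lemma gradB z w w' : grad z w' - grad z w =
  lam *: (w' - w) + n%:R^-1 *: \sum_(i < n)
    ip (w' - w) (feature (tnth z i)) *: feature (tnth z i).
Proof.
rewrite /grad opprD addrACA -scalerBr -scalerBr -sumrB; congr (_ + _ *: _).
apply: eq_bigr => i _; rewrite /loss_grad -scalerBl; congr (_ *: _).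
by rewrite /residual ipBl; ring.
Qed.

(** The gradient for the sample [z'] vanishes at the new minimizer, and at the old
    one it differs from the gradient for [z], which vanishes, by the changes of
    the summands. *)
Lemma rls_dist z z' : in_space z -> in_space z' ->
  `|rls ip lam z' - rls ip lam z| <= 3 * r ^+ 3 * mean_dist z z'.
Proof.
move=> zD z'D; set w := rls ip lam z; set w' := rls ip lam z'.
apply: (le_trans (coercive z' _)); rewrite -gradB rls_grad sub0r normrN.
have -> : grad z' w = n%:R^-1 *: \sum_(i < n)
    (loss_grad w (tnth z' i) - loss_grad w (tnth z i)).
  rewrite -[LHS]subr0 -[X in _ - X = _](rls_grad z) /grad -/w opprD addrACA subrr add0r.
  by rewrite -scalerBr sumrB.
rewrite normrZ ger0_norm ?invr_ge0// /mean_dist.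
have -> : 3 * r ^+ 3 * (n%:R^-1 * \sum_(i < n) dist (tnth z i) (tnth z' i)) =
  r ^+ 2 * (n%:R^-1 * (\sum_(i < n) 3 * r * dist (tnth z i) (tnth z' i))).
  by rewrite -mulr_sumr; ring.
rewrite ler_wpM2l ?sqr_ge0// ler_wpM2l ?invr_ge0//.
apply: (le_trans (ler_norm_sum _ _ _)); apply: ler_sum => i _.
by rewrite distrC; apply: loss_grad_dist => //; exact: rls_norm.
Qed.

Lemma residual_lip w w' p : D p -> `|residual w' p - residual w p| <= `|w' - w|.
Proof.
move=> [x1 _]; rewrite /residual opprD opprK addrACA addNr addr0 -ipBl.
by rewrite (le_trans (cauchy_schwarz ipN _ _))// ler_piMr.
Qed.

Lemma sqr_loss_dist w w' p p' : `|w| <= r -> `|w'| <= r -> D p -> D p' ->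
  `|square_loss ip w' p' - square_loss ip w p| <=
  4 * r * (`|w' - w| + r * dist p p').
Proof.
move=> wr w'r pD p'D.
rewrite /square_loss -!/(residual _ _) subr_sqr normrM mulrC.
apply: ler_pM => //.
  rewrite (le_trans (ler_normD _ _))// (_ : 4 * r = 2 * r + 2 * r); last by ring.
  by rewrite lerD// residual_le.
rewrite (_ : _ - _ = (residual w' p' - residual w p') +
  (residual w p' - residual w p)); last by ring.
rewrite (le_trans (ler_normD _ _))// lerD ?residual_lip//.
by rewrite distrC; exact: residual_dist.
Qed.

Lemma sqr_loss_le w p : `|w| <= r -> D p -> `|square_loss ip w p| <= 4 * r ^+ 2.
Proof.
move=> wr pD; rewrite /square_loss -/(residual _ _) normrX.
have -> : 4 * r ^+ 2 = (2 * r) ^+ 2 by ring.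
by rewrite lerXn2r ?nnegrE ?residual_le// mulr_ge0// ltW.
Qed.

(** The four samples are the corners of a square: the example with index [k]
    changes from [z00] to [z10] and from [z01] to [z11], the example with index
    [l] changes from [z00] to [z01] and from [z10] to [z11]. *)
Section second_difference.
Variables (z00 z10 z01 z11 : n.-tuple Ex) (k l : 'I_n).
Hypotheses (kl : k != l).
Hypotheses (D00 : in_space z00) (D10 : in_space z10) (D01 : in_space z01)
  (D11 : in_space z11).
Hypotheses (k0 : tnth z01 k = tnth z00 k) (k1 : tnth z11 k = tnth z10 k).
Hypotheses (l0 : tnth z10 l = tnth z00 l) (l1 : tnth z11 l = tnth z01 l).
Hypothesis others : forall i, i != k -> i != l ->
  [/\ tnth z10 i = tnth z00 i, tnth z01 i = tnth z00 i & tnth z11 i = tnth z00 i].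

Let w00 := rls ip lam z00.
Let w10 := rls ip lam z10.
Let w01 := rls ip lam z01.
Let w11 := rls ip lam z11.
Let rr := w11 - w10 - w01 + w00.

Variable a : R.
Hypotheses (a10 : `|w10 - w00| <= a) (a01 : `|w01 - w00| <= a)
  (b10 : `|w11 - w01| <= a) (b01 : `|w11 - w10| <= a).

(** The alternating sum of the four normal equations says that the linear part of
    the equation of [z00], applied to [rr], is minus the mean of the [Q i]. *)
Let Q i : H := loss_grad w11 (tnth z11 i) - loss_grad w10 (tnth z10 i)
  - loss_grad w01 (tnth z01 i) + loss_grad w00 (tnth z00 i)
  - ip rr (feature (tnth z00 i)) *: feature (tnth z00 i).

Let Q_swap (h : H) p p' : D p -> D p' ->
  `|ip h (feature p') *: feature p' - ip h (feature p) *: feature p| <= 2 * `|h|.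
Proof.
move=> [px _] [p'x _].
have B (q : Ex) : `|feature q| <= 1 -> `|ip h (feature q) *: feature q| <= `|h|.
  move=> qx; rewrite normrZ -[leRHS]mulr1; apply: ler_pM => //.
  by rewrite (le_trans (cauchy_schwarz ipN _ _))// ler_piMr.
rewrite (le_trans (ler_normB _ _))// mulr_natl mulr2n.
by apply: lerD; exact: B.
Qed.

Let Q_k : `|Q k| <= 2 * a.
Proof.
rewrite /Q k0 k1.
have -> : loss_grad w11 (tnth z10 k) - loss_grad w10 (tnth z10 k)
  - loss_grad w01 (tnth z00 k) + loss_grad w00 (tnth z00 k)
  - ip rr (feature (tnth z00 k)) *: feature (tnth z00 k) =
  ip (w11 - w10) (feature (tnth z10 k)) *: feature (tnth z10 k) -
  ip (w11 - w10) (feature (tnth z00 k)) *: feature (tnth z00 k).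
  rewrite /loss_grad scale_collect -[in RHS]scaleNr.
  by congr (_ *: _ + _ *: _); rewrite /residual /rr /feature !(ipBl, ipDl); ring.
apply: (le_trans (Q_swap _ (D00 k) (D10 k))).
by rewrite ler_wpM2l.
Qed.

Let Q_l : `|Q l| <= 2 * a.
Proof.
rewrite /Q l0 l1.
have -> : loss_grad w11 (tnth z01 l) - loss_grad w10 (tnth z00 l)
  - loss_grad w01 (tnth z01 l) + loss_grad w00 (tnth z00 l)
  - ip rr (feature (tnth z00 l)) *: feature (tnth z00 l) =
  ip (w11 - w01) (feature (tnth z01 l)) *: feature (tnth z01 l) -
  ip (w11 - w01) (feature (tnth z00 l)) *: feature (tnth z00 l).
  rewrite [X in X + loss_grad w00 _ - _]addrAC /loss_grad scale_collect -[in RHS]scaleNr.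
  by congr (_ *: _ + _ *: _); rewrite /residual /rr /feature !(ipBl, ipDl); ring.
apply: (le_trans (Q_swap _ (D00 l) (D01 l))).
by rewrite ler_wpM2l.
Qed.

Let Q_other i : i != k -> i != l -> Q i = 0.
Proof.
move=> ik il; have [e1 e2 e3] := others ik il; rewrite /Q e1 e2 e3.
rewrite /loss_grad -!scalerBl -scalerDl -scalerBl.
rewrite [X in X *: _](_ : _ = 0) ?scale0r//.
by rewrite /residual /rr /feature !(ipBl, ipDl); ring.
Qed.

Let sum_kl (F : 'I_n -> R) c c' : (forall i, i != k -> i != l -> F i <= c') ->
  0 <= c' -> F k <= c -> F l <= c -> \sum_(i < n) F i <= n%:R * c' + 2 * c.
Proof.
move=> Fi c'0 Fk Fl.
rewrite (bigD1 k)//= (bigD1 l) ?(eq_sym l)//= addrA addrC.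
apply: lerD; last by lra.
apply: (@le_trans _ _ (\sum_(i < n | (i != k) && (i != l)) c')).
  by apply: ler_sum => i /andP[]; exact: Fi.
rewrite sumr_const -[c' *+ _]mulr_natl ler_wpM2r// ler_nat.
by rewrite -[leqRHS](card_ord n) max_card.
Qed.

(** Only [Q k] and [Q l] are nonzero, and both contain a first difference of the
    minimizer; this gains a second factor [1 / n]. *)
Lemma rls_second_difference : `|rr| <= r ^+ 2 * (4 * a / n%:R).
Proof.
apply: (le_trans (coercive z00 rr)); rewrite ler_wpM2l ?sqr_ge0//.
have -> : lam *: rr + n%:R^-1 *: \sum_(i < n)
    ip rr (feature (tnth z00 i)) *: feature (tnth z00 i) =
    - (n%:R^-1 *: \sum_(i < n) Q i).
  apply/eqP; rewrite /Q sumrB big_split /= !sumrB scalerBr opprB -subr_eq0.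
  rewrite opprB addrACA subrr addr0.
  have : grad z11 w11 - grad z10 w10 - grad z01 w01 + grad z00 w00 = 0.
    by rewrite !rls_grad !subr0 addr0.
  by rewrite /grad scale_second_difference -/rr => /eqP.
rewrite normrN normrZ ger0_norm ?invr_ge0// mulrC ler_wpM2r ?invr_ge0//.
apply: (le_trans (ler_norm_sum _ _ _)).
apply: (le_trans (sum_kl (c := 2 * a) (c' := 0) _ _ _ _)) => //.
  by move=> i ik il; rewrite Q_other// normr0.
by rewrite mulr0 add0r mulrA -natrM.
Qed.

(** The second difference of a square is twice the product of the first
    differences plus the second difference times a signed sum of values. *)
Lemma loss_second_difference p : D p ->
  `|square_loss ip w11 p - square_loss ip w10 p - square_loss ip w01 p
    + square_loss ip w00 p| <= 2 * a ^+ 2 + 8 * r * `|rr|.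
Proof.
move=> pD.
have -> : square_loss ip w11 p - square_loss ip w10 p - square_loss ip w01 p
    + square_loss ip w00 p =
  2 * ((residual w10 p - residual w00 p) * (residual w01 p - residual w00 p)) +
  ip rr (feature p) *
    (residual w11 p + residual w10 p + residual w01 p - residual w00 p).
  rewrite /rr !(ipBl, ipDl) /square_loss /residual /feature; ring.
apply: (le_trans (ler_normD _ _)); apply: lerD.
  rewrite normrM ger0_norm// ler_wpM2l// normrM expr2.
  by apply: ler_pM => //; rewrite (le_trans (residual_lip _ _ pD)).
rewrite normrM mulrC; apply: ler_pM => //; last first.
  rewrite (le_trans (cauchy_schwarz ipN _ _))// ler_piMr//.
  by case: pD.
have B00 := residual_le (rls_norm D00) pD.
have B10 := residual_le (rls_norm D10) pD.
have B01 := residual_le (rls_norm D01) pD.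
have B11 := residual_le (rls_norm D11) pD.
rewrite (_ : 8 * r = 2 * r + 2 * r + 2 * r + 2 * r); last by ring.
apply: (le_trans (ler_normB _ _)); apply: lerD => //.
apply: (le_trans (ler_normD _ _)); apply: lerD => //.
by apply: (le_trans (ler_normD _ _)); apply: lerD.
Qed.

Let loss_change w w' p : `|w| <= r -> `|w'| <= r -> D p -> `|w' - w| <= a ->
  `|square_loss ip w' p - square_loss ip w p| <= 4 * r * a.
Proof.
move=> wr w'r pD ww'; apply: (le_trans (sqr_loss_dist wr w'r pD pD)).
by rewrite ler_wpM2l ?mulr_ge0 ?(ltW r0)// /dist !subrr !normr0 addr0 mulr0 addr0.
Qed.

(** For the two changed examples the loss itself changes, but the second
    difference of their terms is a difference of two first differences in the
    weight vector, and these terms carry the weight [1 / n]. *)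
Lemma empirical_second_difference :
  `|empirical_risk ip z11 w11 - empirical_risk ip z10 w10
    - empirical_risk ip z01 w01 + empirical_risk ip z00 w00| <=
  2 * a ^+ 2 + 8 * r * `|rr| + 16 * r * a / n%:R.
Proof.
rewrite /empirical_risk -!mulrBr -mulrDr -!sumrB -big_split /=.
rewrite normrM ger0_norm ?invr_ge0// mulrC ler_pdivrMr//.
apply: (le_trans (ler_norm_sum _ _ _)).
have a0 : 0 <= a by exact: le_trans a10.
have N00 := rls_norm D00; have N10 := rls_norm D10.
have N01 := rls_norm D01; have N11 := rls_norm D11.
apply: (le_trans (sum_kl (c := 8 * r * a) (c' := 2 * a ^+ 2 + 8 * r * `|rr|) _ _ _ _)).
- move=> i ik il; have [-> -> ->] := others ik il.
  exact: loss_second_difference.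
- by rewrite addr_ge0// mulr_ge0 ?sqr_ge0// mulr_ge0// ltW.
- rewrite k0 k1 -addrA (_ : 8 * r * a = 4 * r * a + 4 * r * a); last by ring.
  apply: (le_trans (ler_normD _ _)); apply: lerD; first exact: loss_change.
  by rewrite addrC distrC; exact: loss_change.
- have regroup (x1 x2 x3 x4 : R) : x1 - x2 - x3 + x4 = (x1 - x3) + (x4 - x2) by ring.
  rewrite l0 l1 regroup (_ : 8 * r * a = 4 * r * a + 4 * r * a); last by ring.
  apply: (le_trans (ler_normD _ _)); apply: lerD; first exact: loss_change.
  by rewrite distrC; exact: loss_change.
- rewrite le_eqVlt; apply/orP; left; apply/eqP; field.
  by rewrite gt_eqF.
Qed.

End second_difference.

End least_squares.
(** * Measurability *)

Section measurability.
Context (R : realType) (H : completeNormedModType R).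
Local Notation Ex := (example H R).
Local Notation D := (@sample_space R H).

Lemma continuous_measurable_borel (g : H -> R) : continuous g ->
  measurable_fun setT (g : borel H -> R).
Proof.
move=> cg; apply: (measurability _ (RGenOInfty.measurableE R)).
move=> _ [_ [x ->] <-]; rewrite setTI; apply: sub_sigma_algebra.
by apply: open_comp => [y _|]; [exact: cg|exact: interval_open].
Qed.

Lemma norm_sub_continuous (x0 : H) : continuous (fun x : H => `|x - x0|).
Proof.
by move=> x; apply: cvg_norm; apply: cvgB => //; exact: cvg_cst.
Qed.

Lemma measurable_norm_sub (x0 : H) :
  measurable_fun setT (fun p : Ex => `|(p.1 : H) - x0|).
Proof.
exact: (measurableT_comp (continuous_measurable_borel (@norm_sub_continuous x0))
  measurable_fst).
Qed.

Lemma measurable_snd_sub (y0 : R) :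
  measurable_fun setT (fun p : Ex => `|p.2 - y0|).
Proof.
by apply: measurableT_comp => //; apply: measurable_funB => //.
Qed.

Lemma measurable_sample_space : measurable D.
Proof.
rewrite (_ : D = [set p : Ex | `|(p.1 : H) - 0| <= 1] `&` [set p | `|p.2 - 0| <= 1]).
  apply: measurableI.
    rewrite -[X in measurable X]setTI; apply: measurable_fun_ler => //.
    exact: measurable_norm_sub.
  rewrite -[X in measurable X]setTI; apply: measurable_fun_ler => //.
  exact: measurable_snd_sub.
by apply/seteqP; split=> p /=; rewrite !subr0 ler_norml.
Qed.

Definition clip (p : Ex) : Ex := if p \in D then p else (0 : H, 0).

Lemma clip_in p : D (clip p).
Proof.
rewrite /clip; case: ifPn => [/set_mem//|_].
by split; rewrite /= ?normr0 ?lerN10 ?ler01.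
Qed.

Lemma clip_id p : D p -> clip p = p.
Proof. by move=> pD; rewrite /clip mem_set. Qed.

Lemma measurable_clip : measurable_fun setT clip.
Proof.
apply: measurable_fun_ifT => //.
apply: (measurable_fun_bool true); rewrite setTI preimage_mem_true.
exact: measurable_sample_space.
Qed.

Definition base_nbhd (x0 : H) (y0 : R) (m : nat) : set Ex :=
  [set p | `|(p.1 : H) - x0| < m.+1%:R^-1 /\ `|p.2 - y0| < m.+1%:R^-1].

Lemma measurable_base_nbhd x0 y0 m : measurable (base_nbhd x0 y0 m).
Proof.
rewrite (_ : base_nbhd _ _ _ = [set p : Ex | `|(p.1 : H) - x0| < m.+1%:R^-1] `&`
    [set p | `|p.2 - y0| < m.+1%:R^-1]); last by apply/seteqP; split.
apply: measurableI.
  rewrite -[X in measurable X]setTI; apply: measurable_fun_ltr => //.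
  exact: measurable_norm_sub.
rewrite -[X in measurable X]setTI; apply: measurable_fun_ltr => //.
exact: measurable_snd_sub.
Qed.

Lemma dist_base_nbhd x0 y0 m p p' : base_nbhd x0 y0 m p -> base_nbhd x0 y0 m p' ->
  dist p p' <= 4 * m.+1%:R^-1.
Proof.
move=> [px py] [p'x p'y]; rewrite /dist /feature.
have B (V : normedModType R) (u v w : V) (e : R) :
    `|u - w| < e -> `|v - w| < e -> `|u - v| <= 2 * e.
  move=> uw vw; rewrite -(subrKA w) -[w - v]opprB (le_trans (ler_normB _ _))//.
  by rewrite mulr_natl mulr2n lerD// ltW.
have -> : 4 * m.+1%:R^-1 = 2 * m.+1%:R^-1 + 2 * m.+1%:R^-1 :> R by ring.
by apply: lerD; [exact: B px p'x|exact: (B R^o) py p'y].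
Qed.

Hypothesis sepH : separable_space H.

Lemma dense_sequence : exists a : nat -> H, dense (range a).
Proof.
have [A [cA dA]] := sepH.
have [a aA] := pcard_surjP cA.
exists a => O O0 oO; have [x [Ox Ax]] := dA O O0 oO.
by have [i _ ix] := aA x Ax; exists x; split=> //; exists i.
Qed.

Lemma base_nbhd_exists (a : nat -> H) : dense (range a) -> forall m (p : Ex),
  exists j q, base_nbhd (a j) (ratr q) m p.
Proof.
move=> da m p; have m0 : 0 < m.+1%:R^-1 :> R by rewrite invr_gt0.
have [x0 [bx [j _ jx]]] : ball (p.1 : H) m.+1%:R^-1 `&` range a !=set0.
  apply: da; last exact: ball_open.
  by exists (p.1 : H); exact: ballxx.
have [q] : exists q : rat, ratr q \in `]p.2 - m.+1%:R^-1, p.2 + m.+1%:R^-1[.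
  by apply: rat_in_itvoo; rewrite ltrD2l gt0_cp.
rewrite in_itv /= => /andP[q1 q2]; exists j, q; split.
  by move: bx; rewrite -jx -ball_normE.
by rewrite distrC ltr_distl q1 q2.
Qed.

(** A separable metric space has a countable base, so the open sublevel sets of
    [F] are countable unions of products of basic neighbourhoods. *)
Lemma lipschitz_measurable n (F : n.-tuple Ex -> R) (L : R) : 0 < L ->
  (forall z z', in_space z -> in_space z' -> `|F z' - F z| <= L * mean_dist z z') ->
  measurable_fun [set z : n.-tuple Ex | in_space z] F.
Proof.
move=> L0 FL; have [a da] := dense_sequence.
pose index := (n.-tuple (nat * rat) * nat)%type.
pose box (t : index) : set (n.-tuple Ex) := [set z | forall i,
  base_nbhd (a (tnth t.1 i).1) (ratr (tnth t.1 i).2) t.2 (tnth z i)].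
have mbox t : measurable (box t).
  exact: (measurable_rectangle (A := fun i => base_nbhd _ _ _)
    (fun i => measurable_base_nbhd _ _ _)).
have mS : measurable [set z : n.-tuple Ex | in_space z].
  exact: (measurable_rectangle (A := fun=> D) (fun=> measurable_sample_space)).
apply: (measurability _ (RGenInftyO.measurableE R)).
move=> _ [_ [x ->] <-].
pose good (t : index) := forall z, in_space z -> box t z -> F z < x.
rewrite (_ : _ `&` _ = [set z | in_space z] `&`
    \bigcup_t (if `[< good t >] then box t else set0)).
  apply: measurableI => //; apply: countable_bigcupT_measurable => [|t].
    exact: countableP.
  by case: ifP.
apply/seteqP; split=> z /= [zD].
  rewrite in_itv /= => Fx; split=> //.
  (* Points of a common box are at mean distance at most [4 / m.+1]; 5 makes the
     inequality strict. *)
  have e0 : 0 < (x - F z) / (5 * L) by rewrite divr_gt0 ?subr_gt0 ?mulr_gt0.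
  have [m mE] : exists m, m.+1%:R^-1 < (x - F z) / (5 * L).
    by have [m _ /(_ m (leqnn m))] := near_infty_natSinv_lt (PosNum e0); exists m.
  have /choice[jq jqP] : forall i, exists jq : nat * rat,
      base_nbhd (a jq.1) (ratr jq.2) m (tnth z i).
    by move=> i; have [j [q]] := base_nbhd_exists da m (tnth z i); exists (j, q).
  pose t : index := ([tuple jq i | i < n], m).
  have zt : box t z by move=> i; rewrite /= tnth_mktuple; exact: jqP.
  exists t => //; rewrite asboolT// => z' z'D z't.
  have dm : mean_dist z z' <= 4 * m.+1%:R^-1.
    rewrite /mean_dist; have [n0|n0] := posnP n.
      have -> : n%:R^-1 = 0 :> R by rewrite n0 invr0.
      by rewrite mul0r mulr_ge0// invr_ge0.
    rewrite mulrC ler_pdivrMr ?ltr0n//.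
    apply: (@le_trans _ _ (\sum_(i < n) (4 * m.+1%:R^-1))).
      by apply: ler_sum => i _; exact: dist_base_nbhd (zt i) (z't i).
    by rewrite sumr_const card_ord mulr_natr.
  have := FL z z' zD z'D; rewrite ler_norml => /andP[_ FF].
  have L4 : L * mean_dist z z' <= L * (4 * m.+1%:R^-1) by rewrite ler_pM2l.
  suff h : L * (4 * m.+1%:R^-1) < x - F z.
    by have := le_lt_trans (le_trans FF L4) h; rewrite ltrD2r.
  move: mE; rewrite ltr_pdivlMr ?mulr_gt0// => mE.
  have i0 : 0 < m.+1%:R^-1 :> R by rewrite invr_gt0.
  apply: le_lt_trans mE; rewrite -subr_ge0.
  rewrite (_ : _ - _ = L * m.+1%:R^-1); last by ring.
  by rewrite mulr_ge0// ltW.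
move=> [t _]; case: asboolP => // gt zt; split=> //.
by rewrite in_itv /=; exact: gt.
Qed.

End measurability.
(** * The errors of regularized least squares have small interactions *)

Section true_error.
Context (R : realType) (H : completeNormedModType R) (ip : {dot H for idfun}).
Hypotheses (ipN : induces_norm ip) (sepH : separable_space H).
Variables (lam r : R) (n : nat).
Hypotheses (lam0 : 0 < lam) (lam1 : lam < 1) (r0 : 0 < r) (lamr : lam * r ^+ 2 = 1).
Hypothesis n_gt0 : (0 < n)%N.
Local Notation Ex := (example H R).
Local Notation D := (@sample_space R H).
Variable mu : probability Ex R.
Hypothesis muD : mu D = 1%E.
Implicit Types (z : n.-tuple Ex) (w h : H) (p : Ex).

Let n0 : 0 < n%:R :> R. Proof. by rewrite ltr0n. Qed.

Lemma Rintegral_clip (g : Ex -> R) : bounded_measurable (fun x => g (clip x)) ->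
  \int[mu]_(x in D) g x = \int[mu]_x g (clip x).
Proof.
move=> mg.
have mD : measurable D by exact: measurable_sample_space.
have muDC : mu (~` D) = 0%E by rewrite probability_setC// muD subee.
transitivity (\int[mu]_(x in D) g (clip x)).
  by apply: eq_Rintegral => x /set_mem xD; rewrite clip_id.
rewrite /Rintegral; congr fine.
rewrite [RHS](negligible_integral _ _ _ muDC)//; last 2 first.
- exact: measurableC.
- exact: bmf_integrable.
by rewrite setTD setCK.
Qed.

Lemma measurable_square_loss w : measurable_fun setT (square_loss ip w).
Proof.
apply: measurable_funX; apply: measurable_funB => //.
have cw : continuous (ip w : H -> R).
  move=> x; apply/cvgrPdist_lt => e e0.
  have w0 : 0 < `|w| + 1 by rewrite ltr_wpDl.
  near=> y.
  rewrite -(ipBr ip) (le_lt_trans (cauchy_schwarz ipN _ _))//.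
  rewrite (@le_lt_trans _ _ ((`|w| + 1) * `|x - y|))//.
    by rewrite ler_wpM2r// lerDl.
  rewrite mulrC -ltr_pdivlMr//; near: y.
  by apply: cvgr_dist_lt => //; exact: divr_gt0.
exact: (measurableT_comp (continuous_measurable_borel cw) measurable_fst).
Unshelve. all: by end_near. Qed.

Lemma bmf_square_loss w : bounded_measurable (fun x => square_loss ip w (clip x)).
Proof.
split; first exact: (measurableT_comp (measurable_square_loss w) (@measurable_clip R H)).
exists ((`|w| + 1) ^+ 2) => x; rewrite /square_loss normrX lerXn2r ?nnegrE//.
have [x1 /andP[y1 y2]] := clip_in x.
apply: (le_trans (ler_normB _ _)); apply: lerD; last by rewrite ler_norml y1.
by rewrite (le_trans (cauchy_schwarz ipN _ _))// ler_piMr.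
Qed.

Definition risk w : R := \int[mu]_x square_loss ip w (clip x).

Lemma true_errorE z : true_error ip mu lam z = risk (rls ip lam z).
Proof. exact: Rintegral_clip (bmf_square_loss _). Qed.

Definition generalization_gap z : R :=
  true_error ip mu lam z - empirical_error ip lam z.

Lemma gap_dist z z' : in_space z -> in_space z' ->
  `|generalization_gap z' - generalization_gap z| <= 28 * r ^+ 4 * mean_dist z z'.
Proof.
move=> zD z'D.
have B := rls_dist ipN lam0 lam1 r0 lamr n_gt0 zD z'D.
have N := rls_norm ipN lam0 r0 lamr n_gt0 zD.
have N' := rls_norm ipN lam0 r0 lamr n_gt0 z'D.
rewrite /generalization_gap !true_errorE /empirical_error.
set w := rls ip lam z in B N *; set w' := rls ip lam z' in B N' *.
set e := mean_dist z z' in B *.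
have Rd : `|risk w' - risk w| <= 12 * r ^+ 4 * e.
  rewrite /risk -EbB; [|exact: bmf_square_loss|exact: bmf_square_loss].
  apply: Eb_norm_le => [|x].
    by apply: bmfB; exact: bmf_square_loss.
  have xD := clip_in x.
  apply: (le_trans (sqr_loss_dist ipN lam0 lam1 r0 lamr N N' xD xD)).
  rewrite /dist !subrr !normr0 addr0 mulr0 addr0.
  rewrite (_ : 12 * r ^+ 4 * e = 4 * r * (3 * r ^+ 3 * e)); last by ring.
  by rewrite ler_wpM2l// mulr_ge0// ltW.
have Ed : `|empirical_risk ip z' w' - empirical_risk ip z w| <= 16 * r ^+ 4 * e.
  rewrite /empirical_risk -mulrBr -sumrB normrM ger0_norm ?invr_ge0//.
  rewrite mulrC ler_pdivrMr//; apply: (le_trans (ler_norm_sum _ _ _)).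
  apply: (@le_trans _ _ (\sum_(i < n)
      (12 * r ^+ 4 * e + 4 * r ^+ 2 * dist (tnth z i) (tnth z' i)))).
    apply: ler_sum => i _.
    apply: (le_trans (sqr_loss_dist ipN lam0 lam1 r0 lamr N N' (zD i) (z'D i))).
    rewrite mulrDr lerD//; last by rewrite le_eqVlt; apply/orP; left; apply/eqP; ring.
    rewrite (_ : 12 * r ^+ 4 * e = 4 * r * (3 * r ^+ 3 * e)); last by ring.
    by rewrite ler_wpM2l// mulr_ge0// ltW.
  rewrite big_split /= sumr_const card_ord -mulr_sumr.
  have -> : \sum_(i < n) dist (tnth z i) (tnth z' i) = n%:R * e.
    by rewrite /e /mean_dist mulrA mulfV ?mul1r// gt_eqF.
  rewrite -[_ *+ n]mulr_natr.
  rewrite (_ : _ + _ = (12 * r ^+ 4 + 4 * r ^+ 2) * e * n%:R); last by ring.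
  rewrite ler_wpM2r// ler_wpM2r//.
    rewrite /e /mean_dist mulr_ge0 ?invr_ge0//; apply: sumr_ge0 => i _.
    exact: dist_ge0.
  have r1 := r_ge1 lam0 lam1 r0 lamr.
  have r2 : 1 <= r ^+ 2 by rewrite exprn_ege1.
  have -> : r ^+ 4 = r ^+ 2 * r ^+ 2 by ring.
  nra.
have regroup (x y x' y' : R) : (x - y) - (x' - y') = (x - x') - (y - y') by ring.
rewrite regroup.
apply: (le_trans (ler_normB _ _)).
rewrite (_ : 28 * r ^+ 4 * e = 12 * r ^+ 4 * e + 16 * r ^+ 4 * e); last by ring.
exact: lerD.
Qed.

Lemma gap_le z : in_space z -> `|generalization_gap z| <= 8 * r ^+ 2.
Proof.
move=> zD; have N := rls_norm ipN lam0 r0 lamr n_gt0 zD.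
rewrite /generalization_gap true_errorE /empirical_error.
apply: (le_trans (ler_normB _ _)).
rewrite (_ : 8 * r ^+ 2 = 4 * r ^+ 2 + 4 * r ^+ 2); last by ring.
apply: lerD.
  apply: Eb_norm_le => [|x]; first exact: bmf_square_loss.
  exact: (sqr_loss_le ipN lam0 lam1 r0 lamr N (clip_in x)).
rewrite /empirical_risk normrM ger0_norm ?invr_ge0// mulrC ler_pdivrMr//.
apply: (le_trans (ler_norm_sum _ _ _)).
apply: (@le_trans _ _ (\sum_(i < n) (4 * r ^+ 2))).
  by apply: ler_sum => i _; exact: (sqr_loss_le ipN lam0 lam1 r0 lamr N (zD i)).
by rewrite sumr_const card_ord mulr_natr.
Qed.

Lemma in_space_subst z k p : in_space z -> D p -> in_space (subst_coord k p z).
Proof. by move=> zD pD i; rewrite tnth_subst; case: eqP. Qed.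

Lemma mean_dist_subst z k p : in_space z -> D p ->
  mean_dist z (subst_coord k p z) <= 4 / n%:R.
Proof.
move=> zD pD; rewrite /mean_dist mulrC ler_wpM2r ?invr_ge0//.
rewrite (bigD1 k)//= big1 ?addr0 => [|i ik].
  by rewrite tnth_subst eqxx; exact: dist_le4.
by rewrite tnth_subst (negbTE ik) /dist !subrr !normr0 addr0.
Qed.

Lemma gap_subst z k p : in_space z -> D p ->
  `|generalization_gap (subst_coord k p z) - generalization_gap z| <=
  1536 * r ^+ 6 / n%:R.
Proof.
move=> zD pD; apply: (le_trans (gap_dist zD (in_space_subst k zD pD))).
have r1 := r_ge1 lam0 lam1 r0 lamr.
apply: (@le_trans _ _ (28 * r ^+ 4 * (4 / n%:R))).
  by rewrite ler_wpM2l ?mean_dist_subst// mulr_ge0// exprn_ge0// ltW.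
rewrite mulrA ler_wpM2r ?invr_ge0//.
have r2 : 1 <= r ^+ 2 by rewrite exprn_ege1.
have -> : r ^+ 6 = r ^+ 4 * r ^+ 2 by ring.
have r4 : 0 <= r ^+ 4 by rewrite exprn_ge0// ltW.
have := ler_wpM2l r4 r2; rewrite mulr1 => r46; lra.
Qed.

(** The minimizer moves by at most [a] of order [r ^+ 3 / n], its second
    difference is of order [r ^+ 2 * a / n], and losses have size [r ^+ 2]; all
    terms are then at most of order [r ^+ 6 / n ^+ 2]. *)
Lemma gap_interaction z k l p q : k != l -> in_space z -> D p -> D q ->
  `|generalization_gap (subst_coord l q (subst_coord k p z))
    - generalization_gap (subst_coord k p z)
    - generalization_gap (subst_coord l q z) + generalization_gap z| <=
  1536 * r ^+ 6 / n%:R / n%:R.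
Proof.
move=> kl zD pD qD.
set z10 := subst_coord k p z; set z01 := subst_coord l q z.
set z11 := subst_coord l q z10.
have D10 : in_space z10 by exact: in_space_subst.
have D01 : in_space z01 by exact: in_space_subst.
have D11 : in_space z11 by exact: in_space_subst.
have z11E : z11 = subst_coord k p z01 by rewrite /z11 /z10 substC.
have lk : l != k by rewrite eq_sym.
have e1 : tnth z01 k = tnth z k by rewrite tnth_subst (negbTE kl).
have e2 : tnth z11 k = tnth z10 k by rewrite tnth_subst (negbTE kl).
have e3 : tnth z10 l = tnth z l by rewrite tnth_subst (negbTE lk).
have e4 : tnth z11 l = tnth z01 l by rewrite z11E tnth_subst (negbTE lk).
have e5 i : i != k -> i != l ->
    [/\ tnth z10 i = tnth z i, tnth z01 i = tnth z i & tnth z11 i = tnth z i].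
  by move=> /negbTE ik /negbTE il; rewrite /z11 !tnth_subst ik il.
pose a := 12 * r ^+ 3 / n%:R.
have wa z1 j y : in_space z1 -> D y ->
    `|rls ip lam (subst_coord j y z1) - rls ip lam z1| <= a.
  move=> z1D yD.
  apply: (le_trans (rls_dist ipN lam0 lam1 r0 lamr n_gt0 z1D (in_space_subst j z1D yD))).
  rewrite (_ : a = 3 * r ^+ 3 * (4 / n%:R)); last by rewrite /a; ring.
  by rewrite ler_wpM2l ?mean_dist_subst// mulr_ge0// exprn_ge0// ltW.
have a10 := wa z k p zD pD; have a01 := wa z l q zD qD.
have b01 := wa z10 l q D10 qD.
have b10 : `|rls ip lam z11 - rls ip lam z01| <= a by rewrite z11E; exact: wa.
rewrite -/z10 -/z01 -/z11 in a10 a01 b01.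
have S := rls_second_difference ipN lam0 lamr n_gt0 kl zD D10 D01 e1 e2 e3 e4 e5 b10 b01.
have LS x := loss_second_difference ipN lam0 lam1 r0 lamr n_gt0 zD D10 D01 D11
  a10 a01 (clip_in x).
have ES := empirical_second_difference ipN lam0 lam1 r0 lamr n_gt0 kl zD D10 D01 D11
  e1 e2 e3 e4 e5 a10 a01 b10 b01.
rewrite /generalization_gap !true_errorE /empirical_error.
move: S LS ES.
set w00 := rls ip lam z; set w10 := rls ip lam z10.
set w01 := rls ip lam z01; set w11 := rls ip lam z11; set rr := `|_|.
move=> S LS ES.
have RS : `|risk w11 - risk w10 - risk w01 + risk w00| <=
    2 * a ^+ 2 + 8 * r * rr.
  have m11 := bmf_square_loss w11; have m10 := bmf_square_loss w10.
  have m01 := bmf_square_loss w01; have m00 := bmf_square_loss w00.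
  have m2 := bmfB (bmfB m11 m10) m01.
  rewrite /risk -(EbB mu m11 m10) -(EbB mu (bmfB m11 m10) m01) -(EbD mu m2 m00).
  by apply: Eb_norm_le => //; exact: bmfD.
have regroup (x1 x2 x3 x4 y1 y2 y3 y4 : R) :
    (x1 - y1) - (x2 - y2) - (x3 - y3) + (x4 - y4) =
    (x1 - x2 - x3 + x4) - (y1 - y2 - y3 + y4) by ring.
rewrite regroup.
apply: (le_trans (ler_normB _ _)); apply: (le_trans (lerD RS ES)).
have r1 := r_ge1 lam0 lam1 r0 lamr.
have rrle : 8 * r * rr <= 8 * r * (r ^+ 2 * (4 * a / n%:R)).
  by rewrite ler_wpM2l// mulr_ge0// ltW.
apply: (@le_trans _ _ (4 * a ^+ 2 + 16 * r * (r ^+ 2 * (4 * a / n%:R))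
  + 16 * r * a / n%:R)); first by lra.
rewrite (_ : _ + _ = (1344 * r ^+ 6 + 192 * r ^+ 4) / n%:R / n%:R); last first.
  by rewrite /a; field; rewrite gt_eqF.
rewrite ler_wpM2r ?invr_ge0// ler_wpM2r ?invr_ge0//.
have r2 : 1 <= r ^+ 2 by rewrite exprn_ege1.
have -> : r ^+ 6 = r ^+ 4 * r ^+ 2 by ring.
have r4 : 0 <= r ^+ 4 by rewrite exprn_ge0// ltW.
have := ler_wpM2l r4 r2; rewrite mulr1 => r46; lra.
Qed.

(** Composing with [clip] makes the bounds above hold on the whole space, without
    changing anything on the sample space. *)
Definition clip_sample z : n.-tuple Ex := [tuple clip (tnth z i) | i < n].

Lemma clip_sample_in z : in_space (clip_sample z).
Proof. by move=> i; rewrite tnth_mktuple; exact: clip_in. Qed.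

Lemma clip_sample_id z : in_space z -> clip_sample z = z.
Proof.
by move=> zD; apply: eq_from_tnth => i; rewrite tnth_mktuple clip_id.
Qed.

Lemma clip_sample_subst k p z :
  clip_sample (subst_coord k p z) = subst_coord k (clip p) (clip_sample z).
Proof.
apply: eq_from_tnth => i; rewrite tnth_mktuple !tnth_subst tnth_mktuple.
by case: ifP.
Qed.

Lemma measurable_clip_sample : measurable_fun setT clip_sample.
Proof.
apply/measurable_fun_tnthP => i.
rewrite (_ : _ \o _ = (@clip R H) \o (@tnth _ Ex ^~ i)).
  exact: (measurableT_comp (@measurable_clip R H) (measurable_tnth i)).
by apply/funext => z /=; rewrite tnth_mktuple.
Qed.

Definition clipped_gap z : R := generalization_gap (clip_sample z).

Lemma bmf_clipped_gap : bounded_measurable clipped_gap.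
Proof.
split; last first.
  by exists (8 * r ^+ 2) => z; apply: gap_le; exact: clip_sample_in.
have L0 : 0 < 28 * r ^+ 4 by rewrite mulr_gt0// exprn_gt0.
have mS : measurable [set z : n.-tuple Ex | in_space z].
  exact: (measurable_rectangle (A := fun=> D) (fun=> @measurable_sample_space R H)).
apply: (measurable_comp mS _ (lipschitz_measurable sepH L0 gap_dist)
  measurable_clip_sample).
by move=> _ [z _ <-]; exact: clip_sample_in.
Qed.

Lemma clipped_gap_osc k y z :
  `|clipped_gap (subst_coord k y z) - clipped_gap z| <= 1536 * r ^+ 6 / n%:R.
Proof.
rewrite /clipped_gap clip_sample_subst.
by apply: gap_subst; [exact: clip_sample_in|exact: clip_in].
Qed.

Lemma clipped_gap_int k l y y' z : k != l ->
  `|clipped_gap (subst_coord l y' (subst_coord k y z))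
    - clipped_gap (subst_coord k y z) - clipped_gap (subst_coord l y' z)
    + clipped_gap z| <= 1536 * r ^+ 6 / n%:R / n%:R.
Proof.
move=> kl; rewrite /clipped_gap !clip_sample_subst.
by apply: gap_interaction; [|exact: clip_sample_in|exact: clip_in|exact: clip_in].
Qed.

Lemma cond_exp_clip k (g g' : n.-tuple Ex -> R) z : bounded_measurable g' ->
  (forall y, g (subst_coord k (clip y) z) = g' (subst_coord k y z)) ->
  cond_exp mu D k g z = cond_exp mu setT k g' z.
Proof.
move=> mg' gg'; rewrite /cond_exp Rintegral_clip; last first.
  by rewrite (eq_fun gg'); exact: bmf_fiber.
by apply: eq_Rintegral => y _; exact: gg'.
Qed.

(** Almost surely a fresh example lies in the sample space, where [clip] is the
    identity. *)
Lemma sum_cond_var_clip z : in_space z ->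
  sum_cond_var mu D generalization_gap z = sum_cond_var mu setT clipped_gap z.
Proof.
have mG := bmf_clipped_gap.
have GE z1 k y : in_space z1 ->
    generalization_gap (subst_coord k (clip y) z1) = clipped_gap (subst_coord k y z1).
  by move=> z1D; rewrite /clipped_gap clip_sample_subst (clip_sample_id z1D).
move=> zD; apply: eq_bigr => k _; apply: cond_exp_clip.
  by apply: bmf_sqr; apply: bmfB => //; exact: bmf_Ek.
move=> y; rewrite GE//; congr ((_ - _) ^+ 2).
rewrite Ek_subst -(Ek_subst mu k clipped_gap (clip y)).
apply: cond_exp_clip => // y'; apply: GE.
by apply: in_space_subst => //; exact: clip_in.
Qed.

End true_error.
(** * Concentration of the generalization gap *)

Theorem theorem7 (R : realType) :
  exists c : R, 0 < c /\
  forall (H : completeNormedModType R) (ip : {dot H for idfun}),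
    induces_norm ip -> separable_space H ->
  forall (lam : R), 0 < lam < 1 ->
  forall (n : nat), (0 < n)%N ->
  forall (d : measure_display) (Omega : measurableType d)
    (P : probability Omega R) (mu0 : probability (example H R) R)
    (Z : 'I_n -> {RV P >-> example H R}),
    (forall i omega, sample_space (Z i omega)) ->
    mutually_independent P Z ->
    (forall i (A : set (example H R)), measurable A ->
      distribution P (Z i) A = mu0 A) ->
  let bZ : Omega -> n.-tuple (example H R) :=
    fun omega => [tuple Z i omega | i < n] in
  let Delta : n.-tuple (example H R) -> R :=
    fun z => true_error ip mu0 lam z - empirical_error ip lam z in
  let V : R :=
    fine 'E_P[sum_cond_var mu0 (@sample_space R H) Delta \o bZ] in
  forall t : R, 0 < t ->
    (P [set omega | (t < Delta (bZ omega) - fine 'E_P[Delta \o bZ])%R] <=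
     (expR (- (n%:R * t ^+ 2) / (2 * n%:R * V + c * lam ^- 3 * t)))%:E)%E.
Proof.
exists (64 * 1536); split; first by apply: mulr_gt0; rewrite ltr0n.
move=> H ip ipN sepH lam /andP[lam0 lam1] n n0 d Omega P mu0 Z ZD indep ident.
move=> bZ Delta V t t0.
(* The bounds on the gap are monomials in the inverse square root of [lam]. *)
pose r := (Num.sqrt lam)^-1.
have s0 : 0 < Num.sqrt lam by rewrite sqrtr_gt0.
have r0 : 0 < r by rewrite invr_gt0.
have lamr : lam * r ^+ 2 = 1.
  by rewrite /r exprVn sqr_sqrtr ?(ltW lam0)// mulfV// gt_eqF.
have r6 : lam ^- 3 = r ^+ 6.
  by rewrite -[6%N]/(2 * 3)%N exprM /r exprVn sqr_sqrtr ?(ltW lam0)// exprVn.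
have muD : mu0 (@sample_space R H) = 1%E.
  rewrite -(ident (Ordinal n0) _ (@measurable_sample_space R H)) /distribution.
  rewrite /pushforward (_ : _ @^-1` _ = setT) ?probability_setT//.
  by apply/seteqP; split=> // w _; exact: ZD.
have bZD w : in_space (bZ w) by move=> i; rewrite tnth_mktuple.
pose f : n.-tuple (example H R) -> R := clipped_gap ip lam mu0.
have fE w : Delta (bZ w) = f (bZ w).
  by rewrite /f /clipped_gap clip_sample_id.
pose b := 1536 * r ^+ 6 / n%:R.
have n0' : 0 < n%:R :> R by rewrite ltr0n.
have b0 : 0 < b.
  apply: divr_gt0 n0'; apply: mulr_gt0; last exact: exprn_gt0.
  by rewrite ltr0n.
have mf : bounded_measurable f 
  by exact: (bmf_clipped_gap ipN sepH lam0 lam1 r0 lamr n0 muD).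
have f_osc k y z : `|f (subst_coord k y z) - f z| <= b 
  by exact: (clipped_gap_osc ipN lam0 lam1 r0 lamr n0 muD).
have f_int k l y y' z : k != l ->
    `|f (subst_coord l y' (subst_coord k y z)) - f (subst_coord k y z)
      - f (subst_coord l y' z) + f z| <= b / n%:R 
  by exact: (clipped_gap_int ipN lam0 lam1 r0 lamr n0 muD).
have := @bernstein_interaction _ _ _ mu0 n _ _ P bZ n0 (measurable_sample Z)
  (resample_sample indep ident) f b b0 mf f_osc f_int t t0.
set m := \int[P]_w f (bZ w); set V' := \int[P]_w _ => main.
have mE : fine 'E_P[Delta \o bZ] = m.
  by rewrite unlock; apply: eq_Rintegral => w _; exact: fE.
have VE : V = V'.
  rewrite /V unlock; apply: eq_Rintegral => w _.
  exact: (sum_cond_var_clip ipN sepH lam0 lam1 r0 lamr n0 muD).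
have V0 : 0 <= V'.
  apply: Rintegral_ge0 => w _; apply: sumr_ge0 => k _.
  by apply: Rintegral_ge0 => y _; exact: sqr_ge0.
have -> : [set omega | t < Delta (bZ omega) - fine 'E_P[Delta \o bZ]] =
    [set w | t < f (bZ w) - m].
  by apply/seteqP; split=> w /=; rewrite mE fE.
apply: (le_trans main); rewrite lee_fin ler_expR VE r6 le_eqVlt.
apply/orP; left; apply/eqP; rewrite /b -[64 * 1536 * _]mulrA.
set K := 1536 * r ^+ 6 in b0 *.
have K0 : 0 < K by move: b0; rewrite /b pmulr_lgt0// invr_gt0.
clearbody K; field; rewrite (gt_eqF n0') andbT gt_eqF//.
rewrite ltr_wpDl//; last by rewrite mulr_gt0// mulr_gt0.
by rewrite mulr_ge0// mulr_ge0// ltW.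
Qed.
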